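(* Let $k$ be a non-archimedean local field of characteristic different from $2$, with ring of integers $\mathcal{O}$, uniformizing parameter $\pi$ and valuation $\nu$ normalized by $\nu(\pi)=1$. Let $i,j\in\mathbb{M}_2(k)$ be pure quaternions (trace-zero matrices) satisfying $i^2=\alpha$, $j^2=\beta$ and $ij+ji=2\lambda$, with $\alpha,\beta,\lambda\in k$ (scalars are identified with scalar matrices). Assume that $\alpha$ and $\beta$ belong to a set of representatives of all square classes of $k^*$ of the form $$Q=\{1,\Delta,u_1,\dots,u_N,\pi_1,\dots,\pi_{N+2}\},$$ where $\Delta$ is a unit of minimal quadratic defect, $\{u_1,\dots,u_N\}$ is a set of representatives of all square classes of ramified units, and $\{\pi_1,\dots,\pi_{N+2}\}$ is a set of representatives of all square classes of uniformizing parameters. Let $d_f$ be defined case by case as follows, where $\mathfrak{d}(a)$ denotes the quadratic defect of $a$: (1) If $\alpha,\beta\in\{1,\Delta\}$, then $d_f=-\frac12\nu\left(\frac{\lambda^2-\alpha\beta}{4}\right)$. (2) If $\alpha\in\{1,\Delta\}$, while $\beta\notin\{1,\Delta\}$ and $\mathfrak{d}(\beta)=(\pi^{2t+1})$, then $d_f=t-\frac12\nu(\lambda^2-\alpha\beta)$. (3) If $\alpha\notin\{1,\Delta\}$ and $\mathfrak{d}(\alpha)=(\pi^{2s+1})$, while $\beta\in\{1,\Delta\}$, then $d_f=s-\frac12\nu(\lambda^2-\alpha\beta)$. (4) If $\{\alpha,\beta\}\cap\{1,\Delta\}=\emptyset$, while $\mathfrak{d}(\alpha)=(\pi^{2s+1})$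 and $\mathfrak{d}(\beta)=(\pi^{2t+1})$, then $d_f=s+t-\frac12\nu\big(4(\lambda^2-\alpha\beta)\big)$. Then, if $d_f>0$, the number $d_f$ equals the distance, in the Bruhat-Tits tree $\mathfrak{t}(k)$, between the stems $\mathfrak{m}_k(i)$ and $\mathfrak{m}_k(j)$ of the branches of $i$ and $j$; otherwise the two stems intersect and the length of their intersection is $$\min\{-2d_f,\,l(i),\,l(j)\},$$ where $l(q)\in\{0,1,\infty\}$ denotes the stem length of $q\in\{i,j\}$.
   Context: Valuations: $\nu(0)=+\infty$, so $d_f$ may be $-\infty$. Quadratic defect: for $a\in k^*$, $\mathfrak{d}(a)$ is the smallest fractional ideal of $k$ spanned by an element of the form $a-b^2$ with $b\in k$. A unit $\Delta$ of minimal quadratic defect satisfies $\mathfrak{d}(\Delta)=(4)$, and $k(\sqrt\Delta)/k$ is the unramified quadratic extension. A ramified unit is a unit $u\in\mathcal{O}^*$ whose square root generates a ramified quadratic extension of $k$; for such $u$, $\mathfrak{d}(u)=(\pi^{2s+1})$ with $0\le s<\nu(2)$. For a uniformizing parameter $\pi'$, $\mathfrak{d}(\pi')=(\pi)$. $N$ is the number of square classes of ramified units ($N$ may be $0$). Bruhat-Tits tree: $\mathfrak{t}(k)$ is the tree whose vertices are the maximal orders of $\mathbb{M}_2(k)$; two of them $\mathfrak{D},\mathfrak{D}'$ are neighbors if in some basis $\mathfrak{D}=\begin{pmatrix}\mathcal{O}&\mathcal{O}\\ \mathcal{O}&\mathcal{O}\end{pmatrix}$ and $\mathfrak{D}'=\begin{pmatrix}\mathcal{O}&\pi^{-1}\mathcal{O}\\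 \pi\mathcal{O}&\mathcal{O}\end{pmatrix}$. The distance between two vertices is the number of edges of the path joining them, and the distance between two subgraphs is the minimal distance between their vertices. Branches and stems: the branch $\mathfrak{s}_k(q)$ of an integral matrix $q$ is the full subgraph of $\mathfrak{t}(k)$ whose vertices are the maximal orders containing $q$. A thick path of depth $p\ge 0$ is a full subgraph that is the union of the balls of radius $p$ (for the tree distance) centered at the vertices of a walk without backtracking (finite, infinite in one direction, or infinite in both directions); the path formed by the vertices of that walk is its stem. For $q\in\{i,j\}$ as in the claim, $\mathfrak{s}_k(q)$ is a thick path, whose stem is denoted $\mathfrak{m}_k(q)$. The stem length $l(q)$ is the length (number of edges, possibly $\infty$) of $\mathfrak{m}_k(q)$. The length of the intersection of two stems is the number of its edges, length $0$ meaning that the intersection is a single vertex. *)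

(* Defs.v *)
From mathcomp Require Import all_boot all_order all_algebra all_field.
From mathcomp Require Import finmap.
From mathcomp Require Import boolp classical_sets functions cardinality.
From mathcomp Require Import constructive_ereal.

Set Implicit Arguments.
Unset Strict Implicit.
Unset Printing Implicit Defensive.

Import Order.TTheory GRing.Theory Num.Theory.
Local Open Scope classical_set_scope.
Local Open Scope ring_scope.

Record discrete_valuation (F : fieldType) (nu : F -> \bar int) : Prop := {
  dval_eqy : forall x, nu x = +oo%E <-> x = 0;
  dval_neqNy : forall x, nu x <> -oo%E;
  dvalM : forall x y, nu (x * y) = (nu x + nu y)%E;
  dvalD : forall x y, (Order.min (nu x) (nu y) <= nu (x + y)%R)%E;
  dval_norm : exists x, nu x = 1%:E }.

Definition integers (F : fieldType) (nu : F -> \bar int) : set F :=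
  [set x | (0 <= nu x)%E].

Definition complete_valuation (F : fieldType) (nu : F -> \bar int) : Prop :=
  forall x : nat -> F,
    (forall M : int, exists n0 : nat, forall m n : nat,
       (n0 <= m)%N -> (n0 <= n)%N -> (M%:E <= nu (x m - x n)%R)%E) ->
    exists l : F, forall M : int, exists n0 : nat, forall n : nat,
      (n0 <= n)%N -> (M%:E <= nu (x n - l)%R)%E.

Definition finite_residue_field (F : fieldType) (nu : F -> \bar int) : Prop :=
  exists s : seq F, forall x, integers nu x ->
    exists2 y, y \in s & (0 < nu (x - y)%R)%E.

Record nonarch_local_field (k : fieldType) (nu : k -> \bar int) : Prop := {
  lf_valuation : discrete_valuation nu;
  lf_complete : complete_valuation nu;
  lf_residue : finite_residue_field nu }.

Section LocalField.
Variables (k : fieldType) (nu : k -> \bar int).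

Local Notation O := (integers nu).

Definition is_unit_int : set k := [set x | nu x = 0%E].

Definition is_uniformizer : set k := [set x | nu x = 1%:E].

Definition frac_ideal (x : k) : set k := [set x * y | y in O].

(* For a square this is the zero ideal. *)
Definition is_quadratic_defect (a : k) (I : set k) : Prop :=
  (exists b : k, I = frac_ideal (a - b ^+ 2)) /\
  (forall b : k, I `<=` frac_ideal (a - b ^+ 2)).

Definition is_square (x : k) : Prop := exists c : k, x = c ^+ 2.

Definition same_square_class (x y : k) : Prop :=
  exists2 c : k, c != 0 & y = x * c ^+ 2.

Definition square_class_reps (S C : set k) : Prop :=
  C `<=` S /\ forall x, S x -> exists! c, C c /\ same_square_class x c.

(* Squares have defect 0, so minimality is among the units that are not
   squares. *)
Definition is_min_defect_unit (D : k) : Prop :=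
  [/\ is_unit_int D, ~ is_square D &
      exists2 I, is_quadratic_defect D I &
        forall u J, is_unit_int u -> ~ is_square u ->
          is_quadratic_defect u J -> I `<=` J].

(* L = k(sqrt u) is quadratic with ramification index 2: its normalized
   valuation w restricts to 2 nu on k. *)
Definition is_ramified_unit : set k := [set u |
  is_unit_int u /\
  exists (L : fieldExtType k) (r : L) (w : L -> \bar int),
    [/\ r ^+ 2 = u%:A, <<1; r>>%VS = {:L}%VS, \dim {:L} = 2%N,
        discrete_valuation w &
        forall x : k, w x%:A = (nu x + nu x)%E]].

Definition repQ (N : nat) (Delta : k) (u : 'I_N -> k) (p : 'I_(N + 2) -> k) :
  set k := [set 1; Delta] `|` range u `|` range p.

Record square_class_system (N : nat) (Delta : k) (u : 'I_N -> k)
    (p : 'I_(N + 2) -> k) : Prop := {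
  scs_Delta : is_min_defect_unit Delta;
  scs_u_inj : injective u;
  scs_u : square_class_reps is_ramified_unit (range u);
  scs_p_inj : injective p;
  scs_p : square_class_reps is_uniformizer (range p);
  scs_Q : square_class_reps [set x | x != 0] (repQ Delta u p) }.

Definition nuQ (x : k) : \bar rat := er_map (fun n : int => n%:~R) (nu x).

Variable pi : k.

Inductive df_spec (Delta alpha beta lambda : k) : \bar rat -> Prop :=
| Df1 :
    [set 1; Delta] alpha -> [set 1; Delta] beta ->
    df_spec Delta alpha beta lambda
      (- ((1 / 2)%:E * nuQ ((lambda ^+ 2 - alpha * beta) / 4)%R))%E
| Df2 (t : nat) :
    [set 1; Delta] alpha -> ~ [set 1; Delta] beta ->
    is_quadratic_defect beta (frac_ideal (pi ^+ (2 * t + 1))) ->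
    df_spec Delta alpha beta lambda
      (t%:R%:E - (1 / 2)%:E * nuQ (lambda ^+ 2 - alpha * beta)%R)%E
| Df3 (s : nat) :
    ~ [set 1; Delta] alpha ->
    is_quadratic_defect alpha (frac_ideal (pi ^+ (2 * s + 1))) ->
    [set 1; Delta] beta ->
    df_spec Delta alpha beta lambda
      (s%:R%:E - (1 / 2)%:E * nuQ (lambda ^+ 2 - alpha * beta)%R)%E
| Df4 (s t : nat) :
    ~ [set 1; Delta] alpha -> ~ [set 1; Delta] beta ->
    is_quadratic_defect alpha (frac_ideal (pi ^+ (2 * s + 1))) ->
    is_quadratic_defect beta (frac_ideal (pi ^+ (2 * t + 1))) ->
    df_spec Delta alpha beta lambda
      (s%:R%:E + t%:R%:E
       - (1 / 2)%:E * nuQ (4 * (lambda ^+ 2 - alpha * beta))%R)%E.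

Local Notation M2 := 'M[k]_2.

Definition is_full_lattice (D : set M2) : Prop :=
  exists (n : nat) (e : 'I_n -> M2),
    D = [set \sum_(m < n) a m *: e m | a in [set a | forall m, O (a m)]] /\
    forall x : M2, exists a : 'I_n -> k, x = \sum_(m < n) a m *: e m.

Definition is_order (D : set M2) : Prop :=
  [/\ is_full_lattice D, D 1%:M & forall x y, D x -> D y -> D (x *m y)].

Definition is_maximal_order (D : set M2) : Prop :=
  is_order D /\ forall D', is_order D' -> D `<=` D' -> D' = D.

Definition conj_set (g : M2) (X : set M2) : set M2 :=
  [set g *m x *m invmx g | x in X].

Definition std_order : set M2 := [set x | forall a b, O (x a b)].

Definition std_neighbor : set M2 :=
  [set x | [/\ O (x 0 0), frac_ideal pi^-1 (x 0 1),
               frac_ideal pi (x 1 0) & O (x 1 1)]].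

Definition neighbors (D D' : set M2) : Prop :=
  exists2 g : M2, g \in unitmx &
    D = conj_set g std_order /\ D' = conj_set g std_neighbor.

(* Vertices are sets of matrices; a full subgraph of the tree is given by its
   set of vertices. A walk indexed by a set of integers, without
   backtracking. *)
Definition is_walk (I : set int) (w : int -> set M2) : Prop :=
  [/\ forall m, I m -> is_maximal_order (w m),
      forall m, I m -> I (m + 1) -> neighbors (w m) (w (m + 1)) &
      forall m, I m -> I (m + 2) -> w m <> w (m + 2)].

Definition segment (n : nat) : set int := [set m | 0 <= m <= n%:Z].

Definition walk_domain (I : set int) : Prop :=
  [\/ exists n, I = segment n, I = [set m | 0 <= m] | I = setT].

Definition tree_dist (D D' : set M2) (n : nat) : Prop :=
  exists w, [/\ is_walk (segment n) w, w 0 = D & w n%:Z = D'].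

Definition subgraph_dist (A B : set (set M2)) (n : nat) : Prop :=
  (exists D D', [/\ A D, B D' & tree_dist D D' n]) /\
  (forall D D' m, A D -> B D' -> tree_dist D D' m -> (n <= m)%N).

Definition ball (C : set M2) (p : nat) : set (set M2) :=
  [set D | exists2 n, (n <= p)%N & tree_dist C D n].

Definition branch (q : M2) : set (set M2) :=
  [set D | is_maximal_order D /\ D q].

Definition is_stem (S m : set (set M2)) : Prop :=
  exists (p : nat) (I : set int) (w : int -> set M2),
    [/\ walk_domain I, is_walk I w, S = \bigcup_(t in I) ball (w t) p &
        m = w @` I].

Definition stem (q : M2) : set (set M2) := xget set0 (is_stem (branch q)).

Definition edges (A : set (set M2)) : set (set (set M2)) :=
  [set e | exists D D', [/\ A D, A D', neighbors D D' & e = [set D; D']]].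

Definition graph_length (A : set (set M2)) : \bar rat :=
  if `[< finite_set (edges A) >] then (#|` fset_set (edges A)|%fset)%:R%:E
  else +oo%E.

End LocalField.

(* Main.v *)
Require Import Defs.
From mathcomp Require Import all_boot all_order all_algebra.
From mathcomp Require Import finmap.
From mathcomp Require Import boolp classical_sets cardinality.
From mathcomp Require Import constructive_ereal.
From mathcomp Require Import ring zify.

Set Implicit Arguments.
Unset Strict Implicit.
Unset Printing Implicit Defensive.

Import Order.TTheory GRing.Theory Num.Theory.
Local Open Scope classical_set_scope.
Local Open Scope card_scope.
Local Open Scope ring_scope.

(** The idea is to replace [i] and [j] by integral elements adapted to their
    quadratic algebras, for which the whole statement becomes uniform.

    Each [q] among [i], [j] is written [q = b + rho q'] with [b] integral and
    [q'] reduced: the order generated by [q'] is the maximal order of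
    [k[q]].  One may take [rho = 2] when the square of [q] is [1] or [Delta],
    and [rho = pi ^+ s] when the square has defect [(pi ^+ (2 s + 1))].  The
    characteristic polynomial of [q'] is then [X (X - 1)], irreducible modulo
    [pi], or Eisenstein, and the branch of [q'] is correspondingly an apartment,
    a vertex or an edge ([branch_reduced]).

    Vertices are the endomorphism rings of lattices ([maximal_orderE]).  If
    [D = End L] contains [q], then [End (L + q' L)] contains [q'] and lies at
    distance at most [nu rho] from [D] ([branch_near]); the converse inclusion
    is clear from the fact that [dist D D' <= n] iff [pi ^+ n D] is contained in
    [D'] ([dist_le]).  So the branch of [q] is the thick path of depth [nu rho]
    around the branch of [q'], and the latter is the stem, because depth and
    stem of a thick path are determined by the path ([stem_uniq]): the tree has
    valency at least 3, so from every vertex one can walk away from a given path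
    ([escape]).

    Let [C = i' j' - j' i'] be the commutator of the reduced elements.  In all
    four cases of the definition, [- 2 df = nu (\det C)], since
    [\det (i j - j i) = - 4 (lambda ^ 2 - alpha beta)] and passing to [i'] and [j']
    divides this determinant by the squares of the two factors [rho].  It remains to compare
    [nu (\det C)] with the branches of [i'] and [j'], which is a computation
    with matrix entries in a common apartment.

    - If the branches are disjoint, at distance [n], then in the apartment
      through two closest vertices one off-diagonal entry of each matrix has the
      least possible valuation, and [nu (\det C) = - 2 n]
      ([disjoint_branches]).

    - If both branches contain a path of length [L], then
      [nu (\det C) >= L] ([common_path]).

    - If [L] is the largest length of such a path and both stems are longer than
      [L], then [nu (\det C) = L].  Otherwise the reductions of the matrices
      would share an eigenline at an end of the path, which is a common vertex
      beyond that end ([common_point] for [L = 0], [common_segment] for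
      [L > 0]).

    The position of the unramified class rests on the local square theorem
    ([local_square]), which is where completeness enters, and on the existence
    of an irreducible Artin-Schreier polynomial over the finite residue field
    ([irreducible_artin_schreier]). *)

(** * Valuations *)

Section Valuation.
Variables (k : fieldType) (nu : k -> \bar int) (pi : k).
Hypothesis hv : discrete_valuation nu.
Hypothesis hpi : is_uniformizer nu pi.

(** Working with the predicates [n <= nu x] instead of the valuations themselves
    makes the zero element harmless. *)
Definition vge (n : int) (x : k) : bool := (n%:E <= nu x)%E.

Lemma nu0 : nu 0 = +oo%E.
Proof. by apply/(dval_eqy hv). Qed.

Lemma nu_fin x : x != 0 -> exists n : int, nu x = n%:E.
Proof.
move=> x0; case E : (nu x) => [n| |]; first by exists n.
  by move/(dval_eqy hv): E => /eqP; rewrite (negPf x0).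
by case: (dval_neqNy hv E).
Qed.

Lemma nu_neq0 x (n : int) : nu x = n%:E -> x != 0.
Proof. by move=> E; apply/eqP => x0; move: E; rewrite x0 nu0. Qed.

Lemma nuM x y (m n : int) : nu x = m%:E -> nu y = n%:E -> nu (x * y) = (m + n)%:E.
Proof. by move=> hx hy; rewrite (dvalM hv) hx hy. Qed.

Lemma nu1 : nu 1 = 0%E.
Proof.
have [n hn] := nu_fin (oner_neq0 k).
have := nuM hn hn; rewrite mulr1 hn => -[] /eqP.
by rewrite -subr_eq0 opprD addrA subrr add0r oppr_eq0 => /eqP ->.
Qed.

Lemma nuN x : nu (- x) = nu x.
Proof.
have n1 : - 1 != 0 :> k by rewrite oppr_eq0 oner_neq0.
have [n hn] := nu_fin n1.
have := nuM hn hn; rewrite mulrNN mulr1 nu1 => -[] h.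
have n0 : n = 0 by lia.
by rewrite -mulN1r (dvalM hv) hn n0 add0e.
Qed.

Lemma nuV x (n : int) : nu x = n%:E -> nu x^-1 = (- n)%:E.
Proof.
move=> hx; have x0 := nu_neq0 hx.
have [m hm] : exists m : int, nu x^-1 = m%:E by apply: nu_fin; rewrite invr_eq0.
have := nuM hx hm; rewrite mulfV // nu1 => -[] h.
by rewrite hm; congr (_%:E); lia.
Qed.

Lemma pi0 : pi != 0. Proof. exact: nu_neq0 hpi. Qed.

Lemma nuXn x (m : int) (n : nat) : nu x = m%:E -> nu (x ^+ n) = (m * n%:Z)%:E.
Proof.
move=> hx; elim: n => [|n IH]; first by rewrite expr0 nu1 mulr0.
by rewrite exprS (nuM hx IH); congr (_%:E); lia.
Qed.

Lemma nu_piz (n : int) : nu (pi ^ n) = n%:E.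
Proof.
case: n => n; first by rewrite -exprnP (nuXn n hpi) mul1r.
by rewrite NegzE -exprnN (nuV (nuXn n.+1 hpi)) mul1r.
Qed.

Lemma piz_neq0 (n : int) : pi ^ n != 0. Proof. exact: expfz_neq0 pi0. Qed.

Lemma vge0 n : vge n 0. Proof. by rewrite /vge nu0 leey. Qed.

Lemma vge1 : vge 0 1. Proof. by rewrite /vge nu1. Qed.

Lemma vgeD n x y : vge n x -> vge n y -> vge n (x + y).
Proof.
rewrite /vge => hx hy; apply: le_trans (dvalD hv x y).
by rewrite le_min hx hy.
Qed.

Lemma vgeN n x : vge n (- x) = vge n x. Proof. by rewrite /vge nuN. Qed.

Lemma vgeB n x y : vge n x -> vge n y -> vge n (x - y).
Proof. by move=> hx hy; apply: vgeD; rewrite ?vgeN. Qed.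

Lemma vge_fin n m x : nu x = m%:E -> vge n x = (n <= m).
Proof. by rewrite /vge => ->; rewrite lee_fin. Qed.

Lemma vgeM m n x y : vge m x -> vge n y -> vge (m + n) (x * y).
Proof.
case: (eqVneq x 0) => [->|x0]; first by rewrite mul0r !vge0.
case: (eqVneq y 0) => [->|y0]; first by rewrite mulr0 !vge0.
have [a ha] := nu_fin x0; have [b hb] := nu_fin y0.
by rewrite (vge_fin _ ha) (vge_fin _ hb) (vge_fin _ (nuM ha hb)); lia.
Qed.

Lemma vgeW m n x : m <= n -> vge n x -> vge m x.
Proof. by rewrite /vge => mn; apply: le_trans; rewrite lee_fin. Qed.

Lemma vgeMl n x y : vge 0 x -> vge n y -> vge n (x * y).
Proof. by move=> hx hy; rewrite -[n]add0r; apply: vgeM. Qed.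

Lemma vgeMr n x y : vge n x -> vge 0 y -> vge n (x * y).
Proof. by move=> hx hy; rewrite -[n]addr0; apply: vgeM. Qed.

Lemma vgeX n x : vge 0 x -> vge 0 (x ^+ n).
Proof. by move=> hx; elim: n => [|n IH]; rewrite ?vge1 // exprS vgeMl. Qed.

Lemma vge_eq x (n : int) : vge n x -> ~~ vge (n + 1) x -> nu x = n%:E.
Proof.
case: (eqVneq x 0) => [->|x0]; first by rewrite !vge0.
have [a ha] := nu_fin x0.
by rewrite !(vge_fin _ ha) ha => h1 h2; congr (_%:E); lia.
Qed.

Lemma vge_nS x (n : int) : nu x = n%:E -> ~~ vge (n + 1) x.
Proof. by move=> h; rewrite (vge_fin _ h); lia. Qed.

Lemma vgeT x (n : int) : nu x = n%:E -> vge n x.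
Proof. by move=> h; rewrite (vge_fin _ h). Qed.

Lemma nuD x y (n : int) : nu x = n%:E -> vge (n + 1) y -> nu (x + y) = n%:E.
Proof.
move=> hx hy; apply: vge_eq.
  by apply: vgeD; [exact: vgeT | apply: vgeW hy; lia].
apply/negP => h; move/negP: (vge_nS hx); apply.
by rewrite -[x](addrK y); apply: vgeB.
Qed.

Lemma vge_all0 x : (forall n : nat, vge n%:Z x) -> x = 0.
Proof.
move=> H; apply/eqP; apply/negP => /negP x0.
have [a ha] := nu_fin x0.
by have := H (absz a).+1; rewrite (vge_fin _ ha); lia.
Qed.

Lemma vge_pi m n x : vge m (pi ^ n * x) = vge (m - n) x.
Proof.
case: (eqVneq x 0) => [->|x0]; first by rewrite mulr0 !vge0.
have [a ha] := nu_fin x0.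
by rewrite (vge_fin _ ha) (vge_fin _ (nuM (nu_piz n) ha)); lia.
Qed.

Lemma vge_div m n x y : nu y = n%:E -> vge (m + n) x -> vge m (x / y).
Proof.
move=> hy hx; have := vgeM hx (vgeT (nuV hy)).
by rewrite (_ : m + n + - n = m) //; lia.
Qed.

Lemma int_unit x : vge 0 x -> ~~ vge 1 x -> nu x = 0%E.
Proof. exact: vge_eq. Qed.

Lemma vge1M x y : vge 0 x -> vge 0 y -> vge 1 (x * y) -> vge 1 x \/ vge 1 y.
Proof.
move=> hx hy hxy; case: (boolP (vge 1 x)) => h1; [by left|right].
have ux := int_unit hx h1; have x0 := nu_neq0 ux.
by rewrite -[y](mulKf x0) mulrC; apply: (vge_div ux).
Qed.

Lemma piz_unit x (n : int) : nu x = n%:E -> exists2 e, nu e = 0%E & x = pi ^ n * e.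
Proof.
move=> hx; exists (x / pi ^ n).
  by rewrite (nuM hx (nuV (nu_piz n))) subrr.
by rewrite mulrCA divff ?piz_neq0 // mulr1.
Qed.

Lemma integersE x : integers nu x = vge 0 x. Proof. by []. Qed.

Lemma vge_some x : exists N : nat, vge (- N%:Z) x.
Proof.
case: (eqVneq x 0) => [->|x0]; first by exists 0%N; rewrite vge0.
by have [a ha] := nu_fin x0; exists (absz a); rewrite (vge_fin _ ha); lia.
Qed.

Lemma pi_absorbs x : exists N : nat, forall M : nat, (N <= M)%N -> vge 0 (pi ^+ M * x).
Proof.
have [N hN] := vge_some x; exists N => M NM.
by rewrite exprnP vge_pi; apply: vgeW hN; lia.
Qed.

Lemma vge_nat n : vge 0 n%:R.
Proof. by elim: n => [|n IH]; rewrite ?vge0 // -addn1 natrD vgeD ?vge1. Qed.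

(** An element of least valuation generates, and it exists by boundedness. *)
Lemma bounded_submodule_principal (J : set k) (m : int) :
  (forall x, J x -> vge m x) -> (exists2 x, J x & x != 0) ->
  exists2 c, J c & c != 0 /\ forall x, J x -> vge 0 (x / c).
Proof.
move=> bd [x1 J1 x10]; have [a1 ha1] := nu_fin x10.
pose P (n : nat) := `[< exists2 x, J x & nu x = (m + n%:Z)%:E >].
have exP : exists n, P n.
  exists (absz (a1 - m)); apply/asboolP; exists x1 => //.
  have := bd _ J1; rewrite (vge_fin _ ha1) ha1 => h; congr (_%:E); lia.
case: (ex_minnP exP) => n /asboolP [c Jc hc] nmin.
exists c => //; split; first exact: nu_neq0 hc.
move=> x Jx; case: (eqVneq x 0) => [->|x0]; first by rewrite mul0r !vge0.
have [a ha] := nu_fin x0; have am : m <= a by rewrite -(vge_fin _ ha) bd.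
have : (n <= absz (a - m))%N.
  by apply: nmin; apply/asboolP; exists x => //; rewrite ha; congr (_%:E); lia.
by rewrite (vge_fin _ (nuM ha (nuV hc))) => h; lia.
Qed.

(** * Quadratic defects *)

Lemma frac_ideal_sub x y : frac_ideal nu x `<=` frac_ideal nu y ->
  exists2 z, vge 0 z & x = y * z.
Proof.
move=> H; have [|z hz E] := H x; last by exists z.
by exists 1; [exact: vge1 | rewrite mulr1].
Qed.

Lemma sub_frac_ideal x y : y != 0 -> vge 0 (x / y) ->
  frac_ideal nu x `<=` frac_ideal nu y.
Proof.
move=> y0 h _ [z hz <-]; exists (x / y * z); first exact: vgeMl.
by rewrite mulrA mulrCA divff // mulr1.
Qed.

Section Defect.
Hypothesis hc : complete_valuation nu.
Hypothesis hres : finite_residue_field nu.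
Hypothesis h2 : 2%:R != 0 :> k.

(** The map sending [z] to [(y - z ^+ 2) / b] contracts the maximal ideal, so its
    iterates converge to a root. *)
Lemma quadratic_root b y : nu b = 0%E -> vge 1 y ->
  exists2 z, vge 1 z & z ^+ 2 + b * z = y.
Proof.
move=> hb hy; have b0 := nu_neq0 hb.
pose z := fix z (n : nat) : k := if n is m.+1 then (y - z m ^+ 2) / b else 0.
have zS n : z n.+1 = (y - z n ^+ 2) / b by [].
have z1 n : vge 1 (z n).
  elim: n => [|n IH]; first exact: vge0.
  rewrite zS; apply: (vge_div hb); rewrite addr0; apply: vgeB => //.
  by rewrite expr2; apply: vgeMl (IH); apply: vgeW (IH).
have dz n : vge (n%:Z + 1) (z n.+1 - z n).
  elim: n => [|n IH]; first by rewrite subr0 z1.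
  rewrite (_ : z n.+2 - z n.+1 = - ((z n.+1 - z n) * (z n.+1 + z n)) / b); last first.
    by rewrite [z n.+2]zS [X in _ - X = _](zS n); field.
  apply: (vge_div hb); rewrite addr0 vgeN.
  apply: (@vgeW _ (n%:Z + 1 + 1)); first by lia.
  by apply: vgeM => //; apply: vgeD.
have dzm n m : vge (n%:Z + 1) (z (n + m)%N - z n).
  elim: m => [|m IH]; first by rewrite addn0 subrr vge0.
  rewrite addnS -(subrK (z (n + m)%N) (z (n + m).+1)) -addrA; apply: vgeD => //.
  by apply: vgeW (dz _); lia.
have [|l hl] := hc (x := z).
  move=> M; exists (absz M) => m n hm hn.
  case: (leqP m n) => mn.
    rewrite -nuN opprB; have := dzm m (n - m)%N; rewrite subnKC // => h.
    by apply: (vgeW _ h); lia.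
  have := dzm n (m - n)%N; rewrite subnKC; last exact: ltnW.
  by move=> h; apply: (vgeW _ h); lia.
have l1 : vge 1 l.
  have [n0 /(_ n0 (leqnn _)) h] := hl 1.
  by rewrite -[l](subKr (z n0)); apply: vgeB.
exists l => //; apply/eqP; rewrite -subr_eq0; apply/eqP/vge_all0 => n.
have [n0 /(_ (maxn n0 n) (leq_maxl _ _)) h] := hl n.
set m := maxn n0 n in h.
have -> : l ^+ 2 + b * l - y = - b * (z m.+1 - z m) - (z m - l) * (l + z m + b).
  by rewrite zS; field.
have vb : vge 0 b by exact: vgeT.
apply: vgeB.
  apply: vgeMl; first by rewrite vgeN.
  by apply: vgeW (dz m); have := leq_maxr n0 n; lia.
apply: vgeMr => //; apply: vgeD => //.
by apply: vgeW (vgeD l1 (z1 m)).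
Qed.

(** Writing the square root as [b + 2 z] turns the equation into
    [z ^+ 2 + b z = y], a small perturbation of a linear one. *)
Lemma local_square a b y : nu a = 0%E -> vge 1 y -> a = b ^+ 2 + 4 * y -> is_square a.
Proof.
move=> ha hy E.
have v4 : vge 0 4 by exact: vge_nat.
have hb2 : nu (b ^+ 2) = 0%E.
  rewrite (_ : b ^+ 2 = a - 4 * y); last by rewrite E addrK.
  apply: nuD => //; rewrite vgeN; exact: vgeMl.
have b0 : b != 0 by have := nu_neq0 hb2; rewrite expf_eq0.
have [m hm] := nu_fin b0.
have hb : nu b = 0%E.
  by have := nuXn 2 hm; rewrite hb2 hm => -[h]; congr (_%:E); lia.
have [z _ hz] := quadratic_root hb hy.
by exists (b + 2 * z); rewrite E -hz; ring.
Qed.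

Lemma nu2_fin : exists e : nat, nu 2 = e%:Z%:E.
Proof.
have [e he] := nu_fin h2; have := vge_nat 2; rewrite (vge_fin _ he) => h.
by exists (absz e); rewrite he; congr (_%:E); lia.
Qed.

Lemma two_sqr_neq0 : 4 != 0 :> k.
Proof. by rewrite (natrM k 2 2) mulf_neq0. Qed.

Lemma nu4_fin (e : nat) : nu 2 = e%:Z%:E -> nu 4 = (e * 2)%N%:Z%:E.
Proof. by move=> he; rewrite (natrM k 2 2) (nuM he he); congr (_%:E); lia. Qed.

(** The valuation of [a - b ^+ 2] cannot exceed [nu 4], for otherwise [a] would be
    a square; hence it attains a maximum. *)
Lemma defect_exists a : nu a = 0%E -> ~ is_square a ->
  exists b, is_quadratic_defect nu a (frac_ideal nu (a - b ^+ 2)).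
Proof.
move=> ha nsq; have [e he] := nu2_fin; have h4 := nu4_fin he.
have ab0 b : a - b ^+ 2 != 0.
  by rewrite subr_eq0; apply/eqP => E; apply: nsq; exists b.
pose P (n : nat) := `[< exists b, nu (a - b ^+ 2) = n%:Z%:E >].
have exP : exists n, P n by exists 0%N; apply/asboolP; exists 0; rewrite expr0n subr0.
have bd n : P n -> (n <= e * 2)%N.
  move/asboolP => [b hb]; rewrite leqNgt; apply/negP => lt.
  apply: nsq; apply: (@local_square a b ((a - b ^+ 2) / 4)) => //.
    by apply: (vge_div h4); rewrite (vge_fin _ hb); lia.
  by rewrite mulrCA divff ?two_sqr_neq0 // mulr1 addrC subrK.
case: (ex_maxnP exP bd) => n /asboolP [b hb] nmax.
exists b; split; first by exists b.
move=> b'; apply: sub_frac_ideal => //.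
have [m hm] := nu_fin (ab0 b').
rewrite (vge_fin _ (nuM hb (nuV hm))).
case: (lerP m 0) => hm0; first by lia.
have := nmax (absz m); suff : P (absz m) by move=> -> /(_ isT) h; lia.
by apply/asboolP; exists b'; rewrite hm; congr (_%:E); lia.
Qed.

(** The map [r ^+ 2 + r] takes the same value at [0] and [- 1], so it is not
    injective on the finite residue field, hence not onto. *)
Lemma irreducible_artin_schreier :
  exists2 c, vge 0 c & forall r, vge 0 r -> ~~ vge 1 (r ^+ 2 + r - c).
Proof.
have [s hs] := hres.
case: (pselect (exists2 c, vge 0 c & forall r, vge 0 r -> ~~ vge 1 (r ^+ 2 + r - c))) => // nex.
have onto c : vge 0 c -> exists r, vge 0 r && vge 1 (r ^+ 2 + r - c).
  move=> hc0; apply: contrapT => nr; apply: nex; exists c => // r hr.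
  by apply/negP => h; apply: nr; exists r; rewrite hr.
have pos x : ((0 < nu x)%E) = vge 1 x.
  case: (eqVneq x 0) => [->|x0]; first by rewrite vge0 nu0.
  by have [n hn] := nu_fin x0; rewrite (vge_fin _ hn) hn lte_fin; lia.
(* residue classes are encoded by the index of their first representative *)
pose idx x := find (fun y => vge 1 (x - y)) s.
have idx_lt x : vge 0 x -> (idx x < size s)%N.
  move=> hx; rewrite -has_find; apply/hasP.
  by have [y ys] := hs x hx; rewrite pos; exists y.
have idxP x : vge 0 x -> vge 1 (x - nth 0 s (idx x)).
  move=> hx; apply: (@nth_find _ 0 (fun y => vge 1 (x - y))).
  by rewrite has_find; exact: idx_lt.
have idx_eq x y : vge 0 x -> vge 0 y -> idx x = idx y -> vge 1 (x - y).
  move=> hx hy E; rewrite -(subrKA (nth 0 s (idx x))); apply: vgeD; first exact: idxP.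
  by rewrite -vgeN opprB E; exact: idxP.
have eq_idx x y : vge 1 (x - y) -> idx x = idx y.
  move=> h; apply: eq_find => w /=; apply/idP/idP => h'.
    by rewrite (_ : y - w = (x - w) - (x - y)); [exact: vgeB | ring].
  by rewrite (_ : x - w = (y - w) + (x - y)); [exact: vgeD | ring].
pose T := 'I_(size s).
pose A : {set T} := [set t : T | `[< exists2 x, vge 0 x & idx x = t >]]%SET.
have repP (t : T) : exists x, (t \in A) ==> (vge 0 x && (idx x == t)).
  case: (boolP (t \in A)); last by exists 0.
  by rewrite inE => /asboolP [x hx E]; exists x; rewrite hx E /=.
pose rep t := xchoose (repP t).
have repS t : t \in A -> vge 0 (rep t) && (idx (rep t) == t).
  by apply/implyP; exact: xchooseP (repP t).
have rep_in t : t \in A -> vge 0 (rep t) by move=> /repS /andP [].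
have rep_idx t : t \in A -> idx (rep t) = t by move=> /repS /andP [_ /eqP].
have sq_in r : vge 0 r -> vge 0 (r ^+ 2 + r).
  by move=> h; apply: vgeD => //; exact: vgeX.
pose f (t : T) : T := insubd t (idx (rep t ^+ 2 + rep t)).
have fE t : t \in A -> f t = idx (rep t ^+ 2 + rep t) :> nat.
  by move=> tA; rewrite /f val_insubd idx_lt // sq_in // rep_in.
have sq_idx x y : vge 0 x -> vge 0 y -> vge 1 (x - y) ->
    idx (x ^+ 2 + x) = idx (y ^+ 2 + y).
  move=> hx hy h; apply: eq_idx.
  rewrite (_ : x ^+ 2 + x - _ = (x - y) * (x + y + 1)); last by ring.
  by apply: vgeMr => //; do 2?apply: vgeD => //; exact: vge1.
have fA : (A \subset f @: A)%SET.
  apply/fintype.subsetP => t; rewrite inE => /asboolP [c c0 ct].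
  have [r /andP [r0 hr]] := onto c c0.
  have t'A : Ordinal (idx_lt _ r0) \in A by rewrite inE; apply/asboolP; exists r.
  apply/imsetP; exists (Ordinal (idx_lt _ r0)) => //; apply/val_inj => /=.
  rewrite fE // -ct -(eq_idx _ _ hr); apply: sq_idx => //.
    exact: rep_in.
  by apply: idx_eq => //; [exact: rep_in | rewrite rep_idx].
have finj : {in A &, injective f}.
  apply/imset_injP; rewrite eqn_leq leq_imset_card /=.
  exact: subset_leq_card.
have n1 : vge 0 (- 1) by rewrite vgeN vge1.
have inA x (hx : vge 0 x) : Ordinal (idx_lt _ hx) \in A.
  by rewrite inE; apply/asboolP; exists x.
have E : Ordinal (idx_lt _ (vge0 0)) = Ordinal (idx_lt _ n1).
  apply: finj; rewrite ?inA //; apply/val_inj => /=; rewrite !fE ?inA //.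
  have key x (hx : vge 0 x) : idx (rep (Ordinal (idx_lt _ hx)) ^+ 2
      + rep (Ordinal (idx_lt _ hx))) = idx (x ^+ 2 + x).
    apply: sq_idx => //; first exact: rep_in.
    by apply: idx_eq => //; [exact: rep_in | rewrite rep_idx].
  by rewrite !key; congr idx; ring.
have {E} /(congr1 val) /= E := E.
have := idx_eq _ _ (vge0 0) n1 E.
by rewrite sub0r opprK (vge_fin _ nu1).
Qed.

(** A unit [1 + 4 c] with [X ^+ 2 + X - c] irreducible modulo [pi] is not a square
    and its defect lies in [(4)]; by minimality so does the defect of [D], which
    gives [b] and [c].  A root of [X ^+ 2 + b X - c] modulo [pi] would exhibit [D]
    as a square up to [4 pi]. *)
Lemma unramified_generator D : is_min_defect_unit nu D ->
  exists b c, [/\ vge 0 b, vge 0 c, D = b ^+ 2 + 4 * c &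
    forall r, vge 0 r -> ~~ vge 1 (r ^+ 2 + b * r - c)].
Proof.
move=> [uD nsqD [I [[b EI] _] Imin]].
have [e he] := nu2_fin; have h4 := nu4_fin he.
have v2 : vge 0 2 by exact: vge_nat.
have v4 : vge 0 4 by exact: vge_nat.
have [c0 c0i c0irr] := irreducible_artin_schreier.
have uu : nu (1 + 4 * c0) = 0%E.
  apply: int_unit; first by apply: vgeD; [exact: vge1 | exact: vgeMl].
  apply/negP => h; case: e he h4 => [|e] he h4; last first.
    have : vge 1 1.
      rewrite -[X in vge _ X](addrK (4 * c0)); apply: vgeB => //; apply: vgeMr => //.
      by rewrite (vge_fin _ h4); lia.
    by rewrite (vge_fin _ nu1).
  have h2i : vge 0 2^-1 by rewrite (vge_fin _ (nuV he)).
  have := c0irr (- 2^-1); rewrite vgeN => /(_ h2i) /negP; apply.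
  rewrite (_ : _ - c0 = - ((1 + 4 * c0) / 4)); last by field; rewrite h2 two_sqr_neq0.
  by rewrite vgeN; apply: (vge_div h4).
have nsq : ~ is_square (1 + 4 * c0).
  move=> [t ht].
  have hr : ((t - 1) / 2) ^+ 2 + (t - 1) / 2 = c0.
    have -> : c0 = (t ^+ 2 - 1) / 4 by rewrite -ht; field; rewrite ?h2 ?two_sqr_neq0.
    by field; rewrite ?h2 ?two_sqr_neq0.
  suff hi : vge 0 ((t - 1) / 2) by have := c0irr _ hi; rewrite hr subrr vge0.
  set r := (t - 1) / 2 in hr *.
  case: (eqVneq r 0) => [->|r0]; first exact: vge0.
  have [m hm] := nu_fin r0; rewrite (vge_fin _ hm) leNgt; apply/negP => m0.
  have : vge 0 (r * (r + 1)) by rewrite mulrDr mulr1 -expr2 hr.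
  have hr1 : nu (r + 1) = m%:E.
    by apply: nuD => //; rewrite (vge_fin _ nu1); lia.
  by rewrite (vge_fin _ (nuM hm hr1)); lia.
have [b1 hb1] := defect_exists uu nsq.
have sub1 := Imin _ _ uu nsq hb1; rewrite EI in sub1.
have {}sub1 := subset_trans sub1 (hb1.2 1).
have [z hz Ez] := frac_ideal_sub sub1.
have ED : D = b ^+ 2 + 4 * (c0 * z).
  by rewrite -(subrK (b ^+ 2) D) Ez; ring.
have ci : vge 0 (c0 * z) by exact: vgeMl.
have bi : vge 0 b.
  case: (eqVneq b 0) => [->|b0]; first exact: vge0.
  have [m hm] := nu_fin b0; rewrite (vge_fin _ hm).
  have : vge 0 (b ^+ 2).
    rewrite (_ : b ^+ 2 = D - 4 * (c0 * z)); last by rewrite ED addrK.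
    by apply: vgeB; [exact: vgeT | exact: vgeMl].
  by rewrite (vge_fin _ (nuXn 2 hm)); lia.
exists b, (c0 * z); split=> // r hr; apply/negP => h; apply: nsqD.
apply: (@local_square D (2 * r + b) (- (r ^+ 2 + b * r - c0 * z))) => //.
  by rewrite vgeN.
by rewrite ED; ring.
Qed.

(** The bound on [2 b] makes [X ^+ 2 + (2 b / pi ^+ s) X - pi c] Eisenstein.  For
    a unit it says that [2 s + 1 < nu 4], which holds because [a] would otherwise
    be a square, of defect zero; for a uniformizer parity forces [s = 0]. *)
Lemma ramified_generator a (s : nat) : nu a = 0%E \/ nu a = 1%:E ->
  is_quadratic_defect nu a (frac_ideal nu (pi ^+ (2 * s + 1))) ->
  exists b c, [/\ vge 0 b, nu c = 0%E, a = b ^+ 2 + pi ^+ (2 * s + 1) * c &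
     vge (s%:Z + 1) (2 * b)].
Proof.
move=> ha [[b Eb] dmin].
have [z hz Ez] : exists2 z, vge 0 z & a - b ^+ 2 = pi ^+ (2 * s + 1) * z.
  by apply: frac_ideal_sub; rewrite Eb.
have [w hw Ew] : exists2 z, vge 0 z & pi ^+ (2 * s + 1) = (a - b ^+ 2) * z.
  by apply: frac_ideal_sub; rewrite -Eb.
have uz : nu z = 0%E.
  have : z * w = 1.
    apply: (mulfI (expf_neq0 (2 * s + 1) pi0)).
    by rewrite mulrA -Ez -Ew mulr1.
  move=> E; apply: int_unit => //; apply/negP => h.
  by have := vgeMr h hw; rewrite E (vge_fin _ nu1).
have hpis : nu (pi ^+ (2 * s + 1)) = (2 * s + 1)%N%:Z%:E by rewrite exprnP nu_piz.
have hd : nu (a - b ^+ 2) = (2 * s + 1)%N%:Z%:E.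
  by rewrite Ez (nuM hpis uz) addr0.
have Ea : a = b ^+ 2 + pi ^+ (2 * s + 1) * z by rewrite -Ez addrC subrK.
have Eb2 : b ^+ 2 = a + - (pi ^+ (2 * s + 1) * z) by rewrite -Ez opprB addrC subrK.
have [e he] := nu2_fin; have h4 := nu4_fin he.
exists b, z.
case: ha => ha.
  have hb2 : nu (b ^+ 2) = 0%E.
    by rewrite Eb2; apply: nuD => //; rewrite vgeN -Ez (vge_fin _ hd); lia.
  have b0 : b != 0 by have := nu_neq0 hb2; rewrite expf_eq0.
  have [m hm] := nu_fin b0.
  have hb : nu b = 0%E.
    by have := nuXn 2 hm; rewrite hb2 hm => -[h]; congr (_%:E); lia.
  split=> //; first exact: vgeT.
  rewrite (vge_fin _ (nuM he hb)) leNgt; apply/negP => lt.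
  have [||c Ec] := @local_square a b ((a - b ^+ 2) / 4) ha.
  - by apply: (vge_div h4); rewrite (vge_fin _ hd); lia.
  - by rewrite mulrCA divff ?two_sqr_neq0 // mulr1 addrC subrK.
  have := frac_ideal_sub (dmin c); rewrite -Ec subrr => -[y _].
  by rewrite mul0r => /eqP; rewrite expf_eq0 (negPf pi0) andbF.
have vb2 : vge 1 (b ^+ 2).
  by rewrite Eb2; apply: vgeD; [exact: vgeT | rewrite vgeN -Ez (vge_fin _ hd); lia].
have bs : vge 1 b /\ s = 0%N.
  case: s hpis hd {Eb dmin Ez Ew Ea} Eb2 => [|s] hpis hd Eb2.
    split=> //; case: (eqVneq b 0) => [->|b0]; first exact: vge0.
    have [m hm] := nu_fin b0.
    by move: vb2; rewrite (vge_fin _ (nuXn 2 hm)) (vge_fin _ hm); lia.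
  have hb2 : nu (b ^+ 2) = 1%:E.
    rewrite Eb2; apply: nuD => //; rewrite vgeN (vge_fin _ (nuM hpis uz)); lia.
  have b0 : b != 0 by have := nu_neq0 hb2; rewrite expf_eq0.
  have [m hm] := nu_fin b0.
  by have := nuXn 2 hm; rewrite hb2 => -[h]; exfalso; lia.
case: bs => vb s0; split=> //; first by apply: vgeW vb.
rewrite s0.
by apply: vgeMl => //; exact: vge_nat.
Qed.

End Defect.

(** * Matrices of size two *)

Local Notation M2 := 'M[k]_2.
Local Notation std := (std_order nu).

Definition mx2 (a b c d : k) : M2 :=
  \matrix_(i < 2, j < 2)
    if i == 0 then (if j == 0 then a else b) else (if j == 0 then c else d).

Lemma ord2 (P : 'I_2 -> Prop) : P 0 -> P 1 -> forall i, P i.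
Proof.
move=> h0 h1 [[|[|i]] hi] //; [move: h0|move: h1];
  by congr P; apply: val_inj.
Qed.

Lemma sum2 (V : nmodType) (F : 'I_2 -> V) : \sum_(i < 2) F i = F 0 + F 1.
Proof.
by rewrite !big_ord_recl big_ord0 addr0; congr (_ + F _); apply: val_inj.
Qed.

Lemma mx2_00 a b c d : mx2 a b c d 0 0 = a. Proof. by rewrite mxE. Qed.
Lemma mx2_01 a b c d : mx2 a b c d 0 1 = b. Proof. by rewrite mxE. Qed.
Lemma mx2_10 a b c d : mx2 a b c d 1 0 = c. Proof. by rewrite mxE. Qed.
Lemma mx2_11 a b c d : mx2 a b c d 1 1 = d. Proof. by rewrite mxE. Qed.
Definition mx2E := (mx2_00, mx2_01, mx2_10, mx2_11).

Lemma mx2_ext (A B : M2) : A 0 0 = B 0 0 -> A 0 1 = B 0 1 ->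
  A 1 0 = B 1 0 -> A 1 1 = B 1 1 -> A = B.
Proof. by move=> *; apply/matrixP; apply: ord2; apply: ord2. Qed.

Lemma mx2_eta (A : M2) : A = mx2 (A 0 0) (A 0 1) (A 1 0) (A 1 1).
Proof. by apply: mx2_ext; rewrite mx2E. Qed.

Lemma mulmx2E (A B : M2) i j : (A *m B) i j = A i 0 * B 0 j + A i 1 * B 1 j.
Proof. by rewrite mxE sum2. Qed.

Lemma mx2M a b c d a' b' c' d' : mx2 a b c d *m mx2 a' b' c' d' =
  mx2 (a * a' + b * c') (a * b' + b * d') (c * a' + d * c') (c * b' + d * d').
Proof. by apply: mx2_ext; rewrite mulmx2E !mx2E. Qed.

Lemma mx2D a b c d a' b' c' d' : mx2 a b c d + mx2 a' b' c' d' =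
  mx2 (a + a') (b + b') (c + c') (d + d').
Proof. by apply: mx2_ext; rewrite mxE !mx2E. Qed.

Lemma mx2N a b c d : - mx2 a b c d = mx2 (- a) (- b) (- c) (- d).
Proof. by apply: mx2_ext; rewrite mxE !mx2E. Qed.

Lemma mx2Z e a b c d : e *: mx2 a b c d = mx2 (e * a) (e * b) (e * c) (e * d).
Proof. by apply: mx2_ext; rewrite mxE !mx2E. Qed.

Lemma mx2_scalar a : a%:M = mx2 a 0 0 a.
Proof. by apply: mx2_ext; rewrite !mxE. Qed.

Lemma mx2_tr a b c d : \tr (mx2 a b c d) = a + d.
Proof. by rewrite /mxtrace sum2 !mx2E. Qed.

Lemma mx2_det a b c d : \det (mx2 a b c d) = a * d - b * c.
Proof.
rewrite (expand_det_row _ 0) sum2 /cofactor !det_mx11 !mxE /=.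
by rewrite expr0 expr1 mul1r mulN1r mulrN.
Qed.

Lemma mx2_unit a b c d : (mx2 a b c d \in unitmx) = (a * d - b * c != 0).
Proof. by rewrite unitmxE mx2_det unitfE. Qed.

Lemma invmx_uniq (A B : M2) : A *m B = 1%:M -> invmx A = B.
Proof.
move=> AB; have [uA _] := mulmx1_unit AB.
by rewrite -[RHS](mulKmx uA) AB mulmx1.
Qed.

Lemma invmx_mul (A B : M2) : A \in unitmx -> B \in unitmx ->
  invmx (A *m B) = invmx B *m invmx A.
Proof.
move=> uA uB; apply: invmx_uniq.
by rewrite mulmxA -(mulmxA A) mulmxV // mulmx1 mulmxV.
Qed.

Lemma mx2_inv a b c d (e := a * d - b * c) : e != 0 ->
  invmx (mx2 a b c d) = mx2 (d / e) (- b / e) (- c / e) (a / e).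
Proof.
move=> e0; apply: invmx_uniq; rewrite mx2M mx2_scalar.
by congr mx2; rewrite /e; field.
Qed.

Lemma stdE (A : M2) : std A <-> [/\ vge 0 (A 0 0), vge 0 (A 0 1), vge 0 (A 1 0) & vge 0 (A 1 1)].
Proof.
split=> [h|[h1 h2 h3 h4]]; first by split; apply: h.
by rewrite /std_order /=; apply: ord2; apply: ord2.
Qed.

Lemma std_mx2 a b c d : std (mx2 a b c d) <-> [/\ vge 0 a, vge 0 b, vge 0 c & vge 0 d].
Proof. by rewrite stdE !mx2E. Qed.

Lemma std1 : std 1%:M.
Proof. by rewrite mx2_scalar std_mx2; split; rewrite ?vge0 ?vge1. Qed.

Lemma stdD A B : std A -> std B -> std (A + B).
Proof. by move=> hA hB a b; rewrite mxE; apply: vgeD; [apply: hA | apply: hB]. Qed.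

Lemma stdM A B : std A -> std B -> std (A *m B).
Proof.
by move=> hA hB a b; rewrite mulmx2E; apply: vgeD; apply: vgeMl;
  (apply: hA || apply: hB).
Qed.

Lemma stdZ e A : vge 0 e -> std A -> std (e *: A).
Proof. by move=> he hA a b; rewrite mxE; apply: vgeMl => //; apply: hA. Qed.

Lemma conj_setE g (X : set M2) q : g \in unitmx ->
  conj_set g X q <-> X (invmx g *m q *m g).
Proof.
move=> ug; split=> [[x Xx <-]|h].
  by rewrite !mulmxA mulVmx // mul1mx mulmxKV.
exists (invmx g *m q *m g) => //.
by rewrite !mulmxA mulmxV // mul1mx mulmxK.
Qed.

Lemma conj_setM g h (X : set M2) : g \in unitmx -> h \in unitmx ->
  conj_set (g *m h) X = conj_set g (conj_set h X).
Proof.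
move=> ug uh; have ugh : g *m h \in unitmx by rewrite unitmx_mul ug.
apply/seteqP; split=> q.
  move/(conj_setE _ _ ugh) => H; apply/conj_setE => //; apply/conj_setE => //.
  by move: H; rewrite invmx_mul // !mulmxA.
move/(conj_setE _ _ ug)/(conj_setE _ _ uh) => H; apply/conj_setE => //.
by rewrite invmx_mul // !mulmxA; move: H; rewrite !mulmxA.
Qed.

Lemma conj_set1 (X : set M2) : conj_set 1%:M X = X.
Proof.
have u1 : 1%:M \in @unitmx k 2 by exact: unitmx1.
by apply/seteqP; split=> q; rewrite conj_setE // invmx1 mul1mx mulmx1.
Qed.

Lemma conj_setZ c g (X : set M2) : c != 0 -> g \in unitmx ->
  conj_set (c *: g) X = conj_set g X.
Proof.
move=> c0 ug; have uc : c *: g \in unitmx by rewrite unitmxZ ?unitfE.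
apply/seteqP; split=> q; rewrite !conj_setE // invmxZ //;
  by rewrite -!scalemxAl -scalemxAr scalerA mulVf // scale1r.
Qed.

Definition GL2O : set M2 := [set u | [/\ u \in unitmx, std u & std (invmx u)]].

Lemma GL2O_mx2 a b c d : vge 0 a -> vge 0 b -> vge 0 c -> vge 0 d ->
  nu (a * d - b * c) = 0%E -> GL2O (mx2 a b c d).
Proof.
move=> ha hb hc hd he; have e0 := nu_neq0 he.
split; [by rewrite mx2_unit | by apply/std_mx2 | ].
rewrite mx2_inv //; apply/std_mx2; split; apply: (vge_div he); by rewrite addr0 ?vgeN.
Qed.

Lemma GL2O_mul u v : GL2O u -> GL2O v -> GL2O (u *m v).
Proof.
move=> [u1 u2 u3] [v1 v2 v3]; split; first by rewrite unitmx_mul u1.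
  exact: stdM.
by rewrite invmx_mul //; apply: stdM.
Qed.

Lemma conj_GL2O u : GL2O u -> conj_set u std = std.
Proof.
move=> [u1 u2 u3]; apply/seteqP; split=> q.
  move/(conj_setE _ _ u1) => h.
  rewrite (_ : q = u *m (invmx u *m q *m u) *m invmx u); first by do 2?apply: stdM.
  by rewrite !mulmxA mulmxV // mul1mx mulmxK.
by move=> h; apply/conj_setE => //; do 2?apply: stdM.
Qed.

Lemma conj_mulGL2O g u : g \in unitmx -> GL2O u ->
  conj_set (g *m u) std = conj_set g std.
Proof. by move=> ug hu; have [uu _ _] := hu; rewrite (conj_setM _ ug uu) (conj_GL2O hu). Qed.

(** * Apartments *)

Definition dg (t : int) : M2 := mx2 (pi ^ t) 0 0 1.
Definition swap2 : M2 := mx2 0 1 1 0.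
Definition low2 (y : k) : M2 := mx2 1 0 y 1.
Definition upp2 (x : k) : M2 := mx2 1 x 0 1.

Lemma dg_unit t : dg t \in unitmx.
Proof. by rewrite mx2_unit mulr1 mul0r subr0 piz_neq0. Qed.

Lemma dg0 : dg 0 = 1%:M.
Proof. by rewrite mx2_scalar /dg expr0z. Qed.

Lemma dgM s t : dg s *m dg t = dg (s + t).
Proof. by rewrite mx2M /dg; congr mx2; rewrite ?(expfzDr _ _ pi0); ring. Qed.

Lemma dg_inv t : invmx (dg t) = dg (- t).
Proof. by apply: invmx_uniq; rewrite dgM subrr dg0. Qed.

Lemma swap2_unit : swap2 \in unitmx.
Proof. by rewrite mx2_unit mul0r mul1r sub0r oppr_eq0 oner_neq0. Qed.

Lemma swap2_GL2O : GL2O swap2.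
Proof.
apply: GL2O_mx2; rewrite ?vge0 ?vge1 //.
by rewrite mul0r mul1r sub0r nuN nu1.
Qed.

Lemma low2_GL2O y : vge 0 y -> GL2O (low2 y).
Proof. by move=> h; apply: GL2O_mx2; rewrite ?vge0 ?vge1 // !mul1r mul0r subr0 nu1. Qed.

Lemma upp2_GL2O y : vge 0 y -> GL2O (upp2 y).
Proof. by move=> h; apply: GL2O_mx2; rewrite ?vge0 ?vge1 // !mul1r mulr0 subr0 nu1. Qed.

Lemma low2_unit y : low2 y \in unitmx.
Proof. by rewrite mx2_unit mul0r mul1r subr0 oner_neq0. Qed.

Lemma upp2_unit y : upp2 y \in unitmx.
Proof. by rewrite mx2_unit mulr0 mul1r subr0 oner_neq0. Qed.

Lemma low2_inv y : invmx (low2 y) = low2 (- y).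
Proof. by apply: invmx_uniq; rewrite mx2M mx2_scalar; congr mx2; ring. Qed.

Lemma upp2_inv y : invmx (upp2 y) = upp2 (- y).
Proof. by apply: invmx_uniq; rewrite mx2M mx2_scalar; congr mx2; ring. Qed.

(** The endomorphism ring of the lattice [g diag(pi ^ t, 1) O^2].  For fixed [g]
    these vertices form an apartment, parametrized by [t]. *)
Definition apt (g : M2) (t : int) : set M2 := conj_set (g *m dg t) std.

Lemma apt0 g : apt g 0 = conj_set g std.
Proof. by rewrite /apt dg0 mulmx1. Qed.

Lemma mem_apt g t q (m := invmx g *m q *m g) : g \in unitmx ->
  apt g t q <-> [/\ vge 0 (m 0 0), vge t (m 0 1), vge (- t) (m 1 0) & vge 0 (m 1 1)].
Proof.
move=> ug; rewrite /apt conj_setM ?dg_unit // conj_setE // -/m conj_setE ?dg_unit //.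
rewrite dg_inv {1}(mx2_eta m) !mx2M std_mx2 !mul0r !mulr0 !mul1r !mulr1 !addr0 !add0r.
rewrite (_ : pi ^ (- t) * m 0 0 * pi ^ t = m 0 0); last first.
  by rewrite mulrAC -expfzDr ?pi0 // addNr expr0z mul1r.
by rewrite vge_pi (mulrC _ (pi ^ t)) vge_pi !sub0r opprK.
Qed.

Lemma apt_shift g s t : apt (g *m dg s) t = apt g (s + t).
Proof. by rewrite /apt -mulmxA dgM. Qed.

Lemma apt_GL2O g u t s : g \in unitmx -> GL2O u ->
  GL2O (dg (- t) *m u *m dg s) -> apt (g *m u) s = apt g t.
Proof.
move=> ug [uu _ _] H; rewrite /apt -[RHS](conj_mulGL2O _ H) ?unitmx_mul ?ug ?dg_unit //.
by rewrite !mulmxA -(mulmxA g (dg t)) dgM subrr dg0 mulmx1.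
Qed.

Lemma apt_rev g t : g \in unitmx -> apt (g *m swap2) t = apt g (- t).
Proof.
move=> ug; have pt := piz_neq0 t.
rewrite /apt -(@conj_mulGL2O (g *m swap2 *m dg t) _ _ swap2_GL2O); last first.
  by rewrite !unitmx_mul ug swap2_unit dg_unit.
rewrite -(conj_setZ _ pt (g := g *m dg (- t))) ?unitmx_mul ?ug ?dg_unit //.
congr (conj_set _ _); rewrite -!mulmxA scalemxAr; congr (_ *m _).
rewrite !mx2M mx2Z; congr mx2; rewrite ?mul0r ?mulr0 ?addr0 ?add0r ?mul1r ?mulr1 //.
by rewrite -expfzDr ?pi0 // subrr expr0z.
Qed.

(** Integral unipotent matrices fix half of the apartment and move the other
    half: this is how continuations of a path are compared. *)
Lemma apt_low g y t : g \in unitmx -> vge 0 y -> 0 <= t -> apt (g *m low2 y) t = apt g t.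
Proof.
move=> ug hy t0; apply: apt_GL2O => //; first exact: low2_GL2O.
rewrite !mx2M !mul0r !mulr0 !addr0 !add0r !mul1r !mulr1.
rewrite -expfzDr ?pi0 // addNr expr0z; apply: low2_GL2O.
by apply: vgeMl => //; rewrite (vge_fin _ (nu_piz t)).
Qed.

Lemma apt_upp g y s t : g \in unitmx -> vge 0 y -> vge s y -> t <= s ->
  apt (g *m upp2 y) t = apt g t.
Proof.
move=> ug h0 hy ts; apply: apt_GL2O => //; first exact: upp2_GL2O.
rewrite !mx2M !mul0r !mulr0 !addr0 !add0r !mul1r !mulr1.
rewrite -expfzDr ?pi0 // addNr expr0z; rewrite mul0r; apply: upp2_GL2O.
by rewrite vge_pi sub0r opprK; apply: vgeW hy.
Qed.

(** * Distance *)

Definition vertex (D : set M2) : Prop := exists2 g, g \in unitmx & D = conj_set g std.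

Lemma vertex_apt g t : g \in unitmx -> vertex (apt g t).
Proof. by move=> ug; exists (g *m dg t); rewrite ?unitmx_mul ?ug ?dg_unit. Qed.

(** Containment up to scaling measures the distance, see [dist_le]; the triangle
    inequality is then immediate. *)
Definition sub_scaled (n : nat) (D D' : set M2) : Prop :=
  forall q, D q -> D' (pi ^+ n *: q).

Lemma scalemx2E e (A : M2) i j : (e *: A) i j = e * A i j.
Proof. by rewrite mxE. Qed.

Lemma conjK (g q : M2) : g \in unitmx -> invmx g *m (g *m q *m invmx g) *m g = q.
Proof. by move=> ug; rewrite !mulmxA mulVmx // mul1mx mulmxKV. Qed.

Lemma conjZ (g q : M2) e : invmx g *m (e *: q) *m g = e *: (invmx g *m q *m g).
Proof. by rewrite -scalemxAr -scalemxAl. Qed.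

Lemma apt_sub_scaled g a b n : g \in unitmx ->
  sub_scaled n (apt g a) (apt g b) <-> `|a - b| <= n%:Z.
Proof.
move=> ug; split=> [H|ab q /(mem_apt _ _ ug) [h1 h2 h3 h4]].
  have E1 : apt g a (g *m mx2 0 (pi ^ a) 0 0 *m invmx g).
    by apply/mem_apt => //; rewrite conjK // !mx2E !vge0 (vge_fin _ (nu_piz a)).
  have E2 : apt g a (g *m mx2 0 0 (pi ^ (- a)) 0 *m invmx g).
    by apply/mem_apt => //; rewrite conjK // !mx2E !vge0 (vge_fin _ (nu_piz _)).
  have /(mem_apt _ _ ug) := H _ E1; rewrite conjZ conjK // mx2Z !mx2E exprnP => -[_ h1 _ _].
  have /(mem_apt _ _ ug) := H _ E2; rewrite conjZ conjK // mx2Z !mx2E exprnP => -[_ _ h2 _].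
  by move: h1 h2; rewrite !(vge_fin _ (nuM (nu_piz _) (nu_piz _))); lia.
apply/mem_apt => //; rewrite conjZ exprnP; set m := _ *m g in h1 h2 h3 h4 *.
by rewrite !scalemx2E !vge_pi; split; [apply: vgeW h1|apply: vgeW h2|apply: vgeW h3|apply: vgeW h4]; lia.
Qed.

(** Read off in an apartment containing both vertices; by [apt_sub_scaled] the
    result does not depend on the apartment. *)
Definition dist (D D' : set M2) : nat :=
  xget 0%N [set n | exists g, [/\ g \in unitmx, D = apt g 0 & D' = apt g n%:Z]].

Lemma dist_apt g a b : g \in unitmx -> dist (apt g a) (apt g b) = absz (a - b).
Proof.
move=> ug; rewrite /dist; case: xgetP => [n _ [h [uh E1 E2]]|H].
  have key m : (n <= m)%N = (absz (a - b) <= m)%N.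
    have := apt_sub_scaled a b m ug; rewrite E1 E2 (apt_sub_scaled _ _ _ uh) => h0.
    by apply/idP/idP => h1; [have : `|0 - n%:Z| <= m%:Z by lia
      |have : `|a - b| <= m%:Z by lia]; move/h0; lia.
  by apply/eqP; rewrite eqn_leq key leqnn -key leqnn.
exfalso; case: (leP a b) => ab.
  apply: (H (absz (a - b))); exists (g *m dg a); rewrite unitmx_mul ug dg_unit.
  by rewrite !apt_shift addr0; split=> //; congr apt; lia.
apply: (H (absz (a - b))); exists (g *m dg a *m swap2).
rewrite !unitmx_mul ug dg_unit swap2_unit !apt_rev ?unitmx_mul ?ug ?dg_unit //.
by rewrite !apt_shift oppr0 addr0; split=> //; congr apt; lia.
Qed.

Lemma min_entry (m : M2) : m \in unitmx ->
  exists i j, m i j != 0 /\ forall i' j', vge 0 (m i' j' / m i j).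
Proof.
move=> um.
have [[i j] _ H] := Order.TotalTheory.arg_minP (fun p : 'I_2 * 'I_2 => nu (m p.1 p.2))
  (erefl : xpredT ((0, 0) : 'I_2 * 'I_2)).
exists i, j.
have mij : m i j != 0.
  apply/eqP => E; move: um; rewrite (mx2_eta m) mx2_unit => /eqP; apply.
  have z i' j' : m i' j' = 0.
    have := H (i', j') isT; rewrite /= E nu0 leye_eq => /eqP h.
    by apply/(dval_eqy hv).
  by rewrite !z mulr0 subrr.
split=> // i' j'; have [a ha] := nu_fin mij.
apply: (vge_div ha); rewrite add0r.
by have := H (i', j') isT; rewrite /= ha.
Qed.

(** Smith normal form: an entry of least valuation is moved to the lower right
    corner and used as a pivot for its row and column. *)
Lemma cartan (m : M2) : m \in unitmx ->
  exists u (n : nat), GL2O u /\ conj_set m std = conj_set (u *m dg n%:Z) std.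
Proof.
pose P (m : M2) := exists u (n : nat), GL2O u /\ conj_set m std = conj_set (u *m dg n%:Z) std.
rewrite -/(P m).
have Pl m' : m' \in unitmx -> P (swap2 *m m') -> P m'.
  move=> um' [u [n [hu E]]]; exists (swap2 *m u), n; split.
    by apply: GL2O_mul => //; exact: swap2_GL2O.
  have [uu _ _] := hu.
  rewrite -mulmxA conj_setM ?swap2_unit ?unitmx_mul ?uu ?dg_unit // -E.
  rewrite -conj_setM ?swap2_unit ?unitmx_mul ?swap2_unit // mulmxA.
  by rewrite mx2M !mulr0 !mulr1 !addr0 !add0r -mx2_scalar mul1mx.
have Pr m' : m' \in unitmx -> P (m' *m swap2) -> P m'.
  move=> um' [u [n [hu E]]]; exists u, n; split=> //.
  by rewrite -E conj_mulGL2O //; exact: swap2_GL2O.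
have base m' : m' \in unitmx -> m' 1 1 != 0 ->
    (forall i j, vge 0 (m' i j / m' 1 1)) -> P m'.
  rewrite (mx2_eta m') mx2_unit; move: (m' 0 0) (m' 0 1) (m' 1 0) (m' 1 1) => a b c d.
  move=> e0; rewrite mx2E => d0 H.
  have := H 0 0; rewrite mx2E => ha; have := H 0 1; rewrite mx2E => hb.
  have := H 1 0; rewrite mx2E => hc {H}.
  set e := (a * d - b * c) / d ^+ 2.
  have ee : e = a / d - b / d * (c / d) by rewrite /e; field.
  have e1 : e != 0 by rewrite mulf_neq0 ?invr_eq0 ?expf_neq0.
  have [n hn] := nu_fin e1.
  have n0 : 0 <= n by rewrite -(vge_fin _ hn) ee; apply: vgeB => //; exact: vgeMl.
  have [eps heps Ee] := piz_unit hn.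
  have [n' En] : exists n' : nat, n = n'%:Z by exists (absz n); lia.
  exists (upp2 (b / d)), n'; split; first exact: upp2_GL2O.
  have hw : GL2O (mx2 eps 0 0 1).
    by apply: GL2O_mx2; rewrite ?vge0 ?vge1 ?(vgeT heps) // mulr1 mul0r subr0.
  rewrite -[RHS](@conj_mulGL2O (upp2 (b / d) *m dg n'%:Z) (mx2 eps 0 0 1 *m low2 (c / d))).
  - rewrite -[RHS](conj_setZ _ d0); last first.
      by rewrite !unitmx_mul upp2_unit dg_unit low2_unit mx2_unit !andbT /= mulr1 mul0r subr0 (nu_neq0 heps).
    congr (conj_set _ _); rewrite !mx2M mx2Z -En.
    congr mx2; rewrite ?(mulr0, mul0r, addr0, add0r, mulr1, mul1r) -?Ee ?ee; field => //.
  - by rewrite unitmx_mul upp2_unit dg_unit.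
  - by apply: GL2O_mul => //; exact: low2_GL2O.
move=> um; have [i [j [mij H]]] := min_entry um.
have sl (m' : M2) i' j' : (swap2 *m m') i' j' = m' (1 - i') j'.
  by move: i'; apply: ord2; rewrite mulmx2E !mx2E ?subr0 ?subrr ?mul0r ?mul1r ?add0r ?addr0.
have sr (m' : M2) i' j' : (m' *m swap2) i' j' = m' i' (1 - j').
  by move: j'; apply: ord2; rewrite mulmx2E !mx2E ?subr0 ?subrr ?mulr0 ?mulr1 ?add0r ?addr0.
move: i j mij H; apply: ord2; apply: ord2 => mij H.
- apply: Pl => //; apply: Pr; rewrite ?unitmx_mul ?swap2_unit //.
  apply: base; rewrite ?unitmx_mul ?swap2_unit ?um ?sr ?sl ?subrr // => i' j'.
  by rewrite !sr !sl; apply: H.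
- apply: Pl => //; apply: base; rewrite ?unitmx_mul ?swap2_unit ?um ?sl ?subrr // => i' j'.
  by rewrite !sl; apply: H.
- apply: Pr => //; apply: base; rewrite ?unitmx_mul ?swap2_unit ?um ?sr ?subrr // => i' j'.
  by rewrite !sr; apply: H.
- exact: base.
Qed.

Lemma common_apartment D D' : vertex D -> vertex D' ->
  exists g, [/\ g \in unitmx, D = apt g 0 & D' = apt g (dist D D')%:Z].
Proof.
move=> [g ug ->] [h uh ->].
have um : invmx g *m h \in unitmx by rewrite unitmx_mul unitmx_inv ug.
have [u [n [hu E]]] := cartan um; have [uu _ _] := hu.
have ugu : g *m u \in unitmx by rewrite unitmx_mul ug.
have E1 : conj_set g std = apt (g *m u) 0 by rewrite apt0 conj_mulGL2O.
have E2 : conj_set h std = apt (g *m u) n%:Z.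
  rewrite -[h](mulKVmx ug) conj_setM // E -conj_setM ?unitmx_mul ?uu ?dg_unit //.
  by rewrite mulmxA.
by exists (g *m u); rewrite E1 E2 dist_apt // add0r abszN absz_nat.
Qed.

Lemma dist_sym D D' : vertex D -> vertex D' -> dist D D' = dist D' D.
Proof.
move=> vD vD'; have [g [ug E1 E2]] := common_apartment vD vD'.
by rewrite [in RHS]E1 [in RHS]E2 dist_apt // subr0 absz_nat.
Qed.

Lemma dist_le D D' n : vertex D -> vertex D' -> (dist D D' <= n)%N <-> sub_scaled n D D'.
Proof.
move=> vD vD'; have [g [ug E1 E2]] := common_apartment vD vD'.
by rewrite [in sub_scaled _ _ _]E1 [in sub_scaled _ _ _]E2 apt_sub_scaled //; lia.
Qed.

Lemma dist0 D D' : vertex D -> vertex D' -> dist D D' = 0%N <-> D = D'.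
Proof.
move=> vD vD'; have [g [ug E1 E2]] := common_apartment vD vD'; split=> [h|<-].
  by rewrite E1 E2 h.
by rewrite E1 dist_apt // subrr.
Qed.

Lemma dist_triangle D D' D'' : vertex D -> vertex D' -> vertex D'' ->
  (dist D D'' <= dist D D' + dist D' D'')%N.
Proof.
move=> vD vD' vD''; apply/dist_le => // q Dq.
rewrite addnC exprD -scalerA.
have /(dist_le _ vD' vD'') := leqnn (dist D' D''); apply.
by have /(dist_le _ vD vD') := leqnn (dist D D'); apply.
Qed.

Lemma frac_idealE y n x : nu y = n%:E -> frac_ideal nu y x <-> vge n x.
Proof.
move=> hy; split=> [[z hz <-]|h]; first by apply: vgeMr => //; exact: vgeT.
exists (x / y); last by rewrite mulrCA divff ?mulr1 // (nu_neq0 hy).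
by apply: (vge_div hy); rewrite add0r.
Qed.

Lemma conj_std_neighbor g : g \in unitmx -> conj_set g (std_neighbor nu pi) = apt g (- 1).
Proof.
move=> ug; rewrite /apt conj_setM ?dg_unit //; congr conj_set.
have u1 : (1%:M : M2) \in unitmx by exact: unitmx1.
rewrite -[dg _]mul1mx; change (std_neighbor nu pi = apt 1%:M (- 1)).
apply/seteqP; split=> q.
  move=> [h1 /(frac_idealE _ (nuV hpi)) h2 /(frac_idealE _ hpi) h3 h4].
  by apply/mem_apt => //; rewrite invmx1 mul1mx mulmx1; split.
move/(mem_apt _ _ u1); rewrite invmx1 mul1mx mulmx1 => -[h1 h2 h3 h4].
by split=> //; [apply/(frac_idealE _ (nuV hpi)) | apply/(frac_idealE _ hpi)].
Qed.

Lemma neighborsE D E : neighbors nu pi D E <->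
  exists g, [/\ g \in unitmx, D = apt g 0 & E = apt g 1].
Proof.
split=> [[g ug [-> ->]]|[g [ug -> ->]]].
  exists (g *m swap2); rewrite unitmx_mul ug swap2_unit; split=> //.
    by rewrite apt_rev // oppr0 apt0.
  by rewrite apt_rev // conj_std_neighbor.
exists (g *m swap2); first by rewrite unitmx_mul ug swap2_unit.
rewrite -apt0 conj_std_neighbor ?unitmx_mul ?ug ?swap2_unit //.
by rewrite !apt_rev // oppr0 opprK.
Qed.

Lemma neighbors_vertex D E : neighbors nu pi D E -> vertex D /\ vertex E.
Proof. by move/neighborsE => [g [ug -> ->]]; split; exact: vertex_apt. Qed.

Lemma neighbors_dist D E : vertex D -> vertex E -> neighbors nu pi D E <-> dist D E = 1%N.
Proof.
move=> vD vE; split=> [/neighborsE [g [ug -> ->]]|h]; first by rewrite dist_apt.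
by have [g [ug E1 E2]] := common_apartment vD vE; apply/neighborsE; exists g; split=> //; rewrite {1}E2 h.
Qed.

Lemma neighbors_sym D E : neighbors nu pi D E -> neighbors nu pi E D.
Proof.
move=> h; have [vD vE] := neighbors_vertex h.
by apply/neighbors_dist => //; rewrite dist_sym //; apply/neighbors_dist.
Qed.

(** Scaled so that its entry of least valuation is [1], [u] has an integral
    inverse: if [u i j = 1], then [u E_jb u^-1] has the entry [u^-1 b d] at
    [(i, d)]. *)
Lemma stabilizer_std u : u \in unitmx -> conj_set u std = std ->
  exists c u0, [/\ c != 0, GL2O u0 & u = c *: u0].
Proof.
move=> uu E; have [i [j [mij H]]] := min_entry uu.
have iu : (u i j)^-1 != 0 by rewrite invr_eq0.
have uu0 : (u i j)^-1 *: u \in unitmx by rewrite unitmxZ ?unitfE.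
exists (u i j), ((u i j)^-1 *: u); split=> //; last by rewrite scalerA divff // scale1r.
split=> //; first by move=> a b; rewrite mxE mulrC; apply: H.
move=> b d.
have : std (u *m delta_mx j b *m invmx u).
  rewrite -E; exists (delta_mx j b) => // a' b'; rewrite mxE.
  by case: andP => _; rewrite integersE ?vge0 ?vge1.
move=> /(_ i d).
rewrite -mulmxA mxE (bigD1 j) //= big1; last first.
  move=> l lj; rewrite mxE big1 ?mulr0 // => l' _.
  by rewrite mxE (negPf lj) mul0r.
rewrite addr0 mxE (bigD1 b) //= big1; last first.
  by move=> l lb; rewrite mxE (negPf lb) andbF mul0r.
by rewrite addr0 mxE !eqxx mul1r invmxZ // invrK [in X in _ -> X]mxE.
Qed.

(** Local structure of the tree along an apartment: a neighbor of [apt g 0] either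
    is the next vertex towards [apt g n], or it prolongs the path from [apt g n],
    and then the whole configuration lies in an apartment.  The neighbor is the
    line spanned by a column of a matrix in [GL2O], and the alternative is whether
    this line is that of [apt g 1] modulo [pi]. *)
Lemma neighbor_position g n E : g \in unitmx -> neighbors nu pi (apt g 0) E ->
  (0 < n)%N /\ E = apt g 1 \/
  exists g', [/\ g' \in unitmx, apt g 0 = apt g' 0, apt g n%:Z = apt g' n%:Z & E = apt g' (- 1)].
Proof.
move=> ug /neighborsE [h [uh E1 ->]].
have ugi : invmx g \in unitmx by rewrite unitmx_inv.
have [c [u0 [c0 hu0 Eu]]] : exists c u0, [/\ c != 0, GL2O u0 & invmx g *m h = c *: u0].
  apply: stabilizer_std; first by rewrite unitmx_mul ugi.
  by rewrite conj_setM // -apt0 -E1 apt0 -conj_setM // mulVmx // conj_set1.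
have [uu0 s0 _] := hu0.
have Eh : h = c *: (g *m u0) by rewrite scalemxAr -Eu mulKVmx.
have ugu0 : g *m u0 \in unitmx by rewrite unitmx_mul ug.
have -> : apt h 1 = apt (g *m u0) 1.
  by rewrite /apt Eh -scalemxAl conj_setZ // unitmx_mul ugu0 dg_unit.
case: n => [|n].
  right; exists (g *m u0 *m swap2); rewrite unitmx_mul ugu0 swap2_unit !apt_rev //.
  by rewrite oppr0 opprK !apt0 conj_mulGL2O.
have := uu0; rewrite {1}(mx2_eta u0) mx2_unit; set e := _ - _ => e0.
have he : nu e = 0%E.
  have := hu0; rewrite (mx2_eta u0) => -[_ _]; rewrite mx2_inv // -/e.
  move/std_mx2; move/stdE: s0 => [].
  move: (u0 0 0) (u0 0 1) (u0 1 0) (u0 1 1) @e e0 => a b a' d e e0 h1 h2 h3 h4 [h5 h6 h7 h8].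
  apply: int_unit; first by apply: vgeB; apply: vgeMl.
  apply/negP => he; have : vge 1 1; last by rewrite (vge_fin _ nu1).
  rewrite (_ : 1 = (d / e * (a / e) - (- b / e) * (- a' / e)) * e).
    by apply: vgeMl => //; apply: vgeB; apply: vgeMl.
  have ee : e = a * d - b * a' by [].
  by rewrite [LHS](_ : 1 = e * e / e ^+ 2); [rewrite {1}ee; field | field].
move/stdE: s0 => [h1 h2 h3 h4].
case: (boolP (vge 1 (u0 0 1))) => hb.
  left; split=> //; apply: apt_GL2O => //.
  rewrite (mx2_eta u0) !mx2M ?(mulr0, mul0r, addr0, add0r, mulr1, mul1r).
  apply: GL2O_mx2 => //.
  - by rewrite -mulrA vge_pi; apply: vgeMl => //; rewrite (vge_fin _ hpi).
  - by rewrite vge_pi.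
  - by apply: vgeMl => //; exact: vgeW (vgeT hpi).
  - rewrite [X in nu X](_ : _ = e) // expr1z exprN1 /e; field; exact: pi0.
right; set y := u0 1 1 / u0 0 1.
have hub := int_unit h2 hb; have b0 := nu_neq0 hub.
have hy : vge 0 y by apply: (vge_div hub); rewrite addr0.
have ul : g *m low2 y \in unitmx by rewrite unitmx_mul ug low2_unit.
exists (g *m low2 y); split=> //.
- by rewrite !apt0 conj_mulGL2O //; exact: low2_GL2O.
- by rewrite apt_low.
pose v := mx2 (u0 0 1) (u0 0 0) 0 (u0 1 0 - y * u0 0 0).
have hyv : vge 0 (u0 1 0 - y * u0 0 0) by apply: vgeB => //; exact: vgeMl.
have dv : u0 0 1 * (u0 1 0 - y * u0 0 0) = - e by rewrite /y /e; field.
have -> : g *m u0 = g *m low2 y *m v *m swap2.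
  rewrite -!mulmxA; congr (_ *m _); rewrite {1}(mx2_eta u0) !mx2M.
  by congr mx2; rewrite /y; field.
have hv' : GL2O v by apply: GL2O_mx2; rewrite ?vge0 // mulr0 subr0 dv nuN.
have [uv _ _] := hv'.
rewrite apt_rev ?unitmx_mul ?ug ?low2_unit //; apply: apt_GL2O => //.
rewrite opprK !mx2M ?(mulr0, mul0r, addr0, add0r, mulr1, mul1r).
apply: GL2O_mx2; rewrite ?vge0 //.
- by rewrite mulrAC -expfzDr ?pi0 // subrr expr0z mul1r.
- by apply: vgeMl => //; exact: vgeW (vgeT hpi).
- by rewrite mulr0 subr0 [pi ^ 1 * _ * _]mulrAC -expfzDr ?pi0 // subrr expr0z mul1r dv nuN.
Qed.

Lemma neighbor_cases D E X : vertex X -> neighbors nu pi D E ->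
  dist E X = (dist D X).+1 \/ dist D X = (dist E X).+1.
Proof.
move=> vX DE; have [vD vE] := neighbors_vertex DE.
have [g [ug E1 E2]] := common_apartment vD vX.
move: DE; rewrite E1 => DE.
have [[n0 Eg]|[g' [ug' F1 F2 F3]]] := neighbor_position (dist D X) ug DE.
  by right; rewrite -E1 {2}E2 Eg dist_apt //; lia.
by left; rewrite F3 {1}E2 F2 -E1 dist_apt //; lia.
Qed.

Lemma closer_neighbor_uniq D E E' X : vertex X -> neighbors nu pi D E ->
  neighbors nu pi D E' -> (dist E X < dist D X)%N -> (dist E' X < dist D X)%N -> E = E'.
Proof.
move=> vX DE DE' h h'; have [vD vE] := neighbors_vertex DE.
have [g [ug E1 E2]] := common_apartment vD vX.
have key F : neighbors nu pi D F -> (dist F X < dist D X)%N -> F = apt g 1.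
  move=> DF; rewrite E1 in DF.
  have [[n0 ->] //|[g' [ug' F1 F2 F3]]] := neighbor_position (dist D X) ug DF.
  by rewrite F3 {1}E2 F2 dist_apt //; lia.
by rewrite (key E) // (key E').
Qed.

(** * Maximal orders *)

(** Hermite normal form: the second coordinates form a fractional ideal,
    generated by [y0], and the vectors with second coordinate zero form another
    one, generated by [x1]. *)
Lemma lattice_basis (L : k -> k -> Prop) (m : int) :
  (forall x y x' y', L x y -> L x' y' -> L (x + x') (y + y')) ->
  (forall c x y, vge 0 c -> L x y -> L (c * x) (c * y)) ->
  (forall x y, L x y -> vge m x /\ vge m y) ->
  (forall x y, exists n : nat, L (pi ^+ n * x) (pi ^+ n * y)) ->
  exists x1 x0 y0, [/\ x1 != 0, y0 != 0 &
    forall x y, L x y <-> vge 0 (y / y0) /\ vge 0 ((x - x0 * (y / y0)) / x1)].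
Proof.
move=> LD LZ Lb La.
have [y0 [x0 L0] [y0n hy0]] : exists2 y0, exists x0, L x0 y0 &
    y0 != 0 /\ forall y, (exists x, L x y) -> vge 0 (y / y0).
  apply: (@bounded_submodule_principal (fun y => exists x, L x y) m).
    by move=> y [x /Lb []].
  have [n hn] := La 0 1; exists (pi ^+ n * 1); first by exists (pi ^+ n * 0).
  by rewrite mulr1 expf_neq0 // pi0.
have [x1 L1 [x1n hx1]] : exists2 x1, L x1 0 & x1 != 0 /\ forall x, L x 0 -> vge 0 (x / x1).
  apply: (@bounded_submodule_principal (fun x => L x 0) m); first by move=> x /Lb [].
  have [n hn] := La 1 0; exists (pi ^+ n * 1); first by rewrite mulr0 in hn.
  by rewrite mulr1 expf_neq0 // pi0.
exists x1, x0, y0; split=> // x y; split=> [Lxy|[ht hs]].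
  have ht : vge 0 (y / y0) by apply: hy0; exists x.
  split=> //; apply: hx1.
  have nt : vge 0 (- (y / y0)) by rewrite vgeN.
  have := LD _ _ _ _ Lxy (LZ _ _ _ nt L0).
  by rewrite !mulNr divfK // subrr (mulrC x0).
have := LD _ _ _ _ (LZ _ _ _ hs L1) (LZ _ _ _ ht L0).
by rewrite mulr0 add0r !divfK // (mulrC x0) subrK.
Qed.

Lemma lattice_endo (L : k -> k -> Prop) x1 x0 y0 (h := mx2 x1 x0 0 y0) (A : M2) :
  x1 != 0 -> y0 != 0 ->
  (forall x y, L x y <-> vge 0 (y / y0) /\ vge 0 ((x - x0 * (y / y0)) / x1)) ->
  (forall x y, L x y -> L (A 0 0 * x + A 0 1 * y) (A 1 0 * x + A 1 1 * y)) ->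
  conj_set h std A.
Proof.
move=> x1n y0n LE LA.
have e0 : x1 * y0 - x0 * 0 != 0 by rewrite mulr0 subr0 mulf_neq0.
apply/conj_setE; first by rewrite mx2_unit.
rewrite mx2_inv // (mx2_eta A) !mx2M; apply/std_mx2.
have /LA /LE [h1 h2] : L x1 0.
  by apply/LE; rewrite mul0r mulr0 subr0 divff // vge0 vge1.
have /LA /LE [h3 h4] : L x0 y0.
  by apply/LE; rewrite divff // mulr1 subrr mul0r vge0 vge1.
rewrite !mulr0 !addr0 in h1 h2.
split; [move: h2|move: h4|move: h1|move: h3]; congr (is_true (vge _ _));
  by field; rewrite x1n y0n.
Qed.

Lemma full_lattice_facts D : is_full_lattice nu D ->
  [/\ forall A B, D A -> D B -> D (A + B),
      forall c A, vge 0 c -> D A -> D (c *: A),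
      exists m : int, forall A, D A -> forall i j, vge m (A i j) &
      forall A, exists n : nat, D (pi ^+ n *: A)].
Proof.
move=> [n [e [-> sp]]]; split.
- move=> _ _ [a ha <-] [b hb <-]; exists (fun m => a m + b m).
    by move=> m; apply: vgeD; [exact: ha|exact: hb].
  by rewrite -big_split; apply: eq_bigr => m _; rewrite scalerDl.
- move=> c _ hc [a ha <-]; exists (fun m => c * a m).
    by move=> m; apply: vgeMl => //; exact: ha.
  by rewrite scaler_sumr; apply: eq_bigr => m _; rewrite scalerA.
- have bd (A : M2) : exists N : nat, forall i j, vge (- N%:Z) (A i j).
    have [a ha] := vge_some (A 0 0); have [b hb] := vge_some (A 0 1).
    have [c hc] := vge_some (A 1 0); have [d hd] := vge_some (A 1 1).
    exists (a + b + c + d)%N; apply: ord2; apply: ord2;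
      [apply: vgeW ha|apply: vgeW hb|apply: vgeW hc|apply: vgeW hd]; lia.
  pose N m := projT1 (cid (bd (e m))).
  have hN m i j : vge (- (N m)%:Z) (e m i j) by exact: projT2 (cid (bd (e m))) i j.
  exists (- (\sum_(m < n) N m)%N%:Z) => _ [a ha <-] i j.
  rewrite summxE; apply: (big_ind (vge _)); first exact: vge0.
    by move=> x y; apply: vgeD.
  move=> m _; rewrite mxE; apply: vgeMl; first exact: ha.
  by apply: vgeW (hN m i j); rewrite (bigD1 m) //=; lia.
- move=> A; have [a ->] := sp A.
  pose N m := projT1 (cid (vge_some (a m))).
  have hN m : vge (- (N m)%:Z) (a m) by exact: projT2 (cid (vge_some (a m))).
  exists (\sum_(m < n) N m)%N; exists (fun m => pi ^+ (\sum_(m < n) N m)%N * a m).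
    move=> m; rewrite integersE exprnP vge_pi.
    by apply: vgeW (hN m); rewrite (bigD1 m) //=; lia.
  by rewrite scaler_sumr; apply: eq_bigr => m _; rewrite scalerA.
Qed.

(** The first columns of the elements of an order form a lattice stable under
    the order. *)
Lemma order_in_vertex D : is_order nu D -> exists2 h, h \in unitmx & D `<=` conj_set h std.
Proof.
move=> [/full_lattice_facts [DD DZ [m Dm] Da] _ DM].
pose L x y := exists2 A, D A & A 0 0 = x /\ A 1 0 = y.
have [||||x1 [x0 [y0 [x1n y0n LE]]]] := @lattice_basis L m.
- move=> x y x' y' [A DA [<- <-]] [B DB [<- <-]]; exists (A + B); first exact: DD.
  by rewrite !mxE.
- move=> c x y hc [A DA [<- <-]]; exists (c *: A); first exact: DZ.
  by rewrite !mxE.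
- by move=> x y [A DA [<- <-]]; split; apply: Dm.
- move=> x y; have [n hn] := Da (mx2 x 0 y 0); exists n, (pi ^+ n *: mx2 x 0 y 0) => //.
  by rewrite mx2Z !mx2E.
exists (mx2 x1 x0 0 y0); first by rewrite mx2_unit mulr0 subr0 mulf_neq0.
move=> A DA; apply: (lattice_endo x1n y0n LE) => x y [B DB [<- <-]].
by exists (A *m B); [exact: DM | rewrite !mulmx2E].
Qed.

Lemma vertex_order D : vertex D -> is_order nu D.
Proof.
move=> [g ug ->]; split.
- pose T := ('I_2 * 'I_2)%type.
  exists #|{: T}|, (fun m => g *m delta_mx (enum_val m).1 (enum_val m).2 *m invmx g).
  have key (f : T -> k) : \sum_(m < #|{: T}|) f (enum_val m) *:
      (g *m delta_mx (enum_val m).1 (enum_val m).2 *m invmx g) =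
      g *m (\matrix_(i, j) f (i, j)) *m invmx g.
    rewrite [X in g *m X](matrix_sum_delta) pair_big /= mulmx_sumr mulmx_suml.
    rewrite (reindex _ (onW_bij _ (@enum_val_bij T))) /=; apply: eq_bigr => m _.
    by rewrite mxE -surjective_pairing -scalemxAr -scalemxAl.
  split.
    apply/seteqP; split=> [_ [A hA <-]|_ [a ha <-]].
      exists (fun m => A (enum_val m).1 (enum_val m).2); first by move=> m; apply: hA.
      rewrite (key (fun p => A p.1 p.2)); congr (_ *m _ *m _).
      by apply/matrixP => i j; rewrite mxE.
    have -> : \sum_(m < #|{: T}|) a m *: (g *m delta_mx (enum_val m).1 (enum_val m).2 *m invmx g)
        = g *m (\matrix_(i, j) a (enum_rank (i, j))) *m invmx g.
      rewrite -(key (fun p => a (enum_rank p))).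
      by apply: eq_bigr => m _; rewrite enum_valK.
    by eexists; last reflexivity; move=> i j; rewrite mxE; apply: ha.
  move=> A; exists (fun m => (invmx g *m A *m g) (enum_val m).1 (enum_val m).2).
  rewrite (key (fun p => (invmx g *m A *m g) p.1 p.2)).
  rewrite (_ : \matrix_(i, j) _ = invmx g *m A *m g).
    by rewrite !mulmxA mulmxV // mul1mx mulmxK.
  by apply/matrixP => i j; rewrite mxE.
- by apply/conj_setE => //; rewrite mulmx1 mulVmx //; exact: std1.
- move=> A B /(conj_setE _ _ ug) hA /(conj_setE _ _ ug) hB; apply/conj_setE => //.
  rewrite (_ : _ *m g = invmx g *m A *m g *m (invmx g *m B *m g)); first exact: stdM.
  by rewrite !mulmxA mulmxK.
Qed.

Lemma maximal_orderE D : is_maximal_order nu D <-> vertex D.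
Proof.
split=> [[oD Dmax]|vD].
  have [h uh Dh] := order_in_vertex oD.
  have vh : vertex (conj_set h std) by exists h.
  by rewrite -(Dmax _ (vertex_order vh) Dh).
split=> [|D' oD' DD']; first exact: vertex_order.
have [h uh D'h] := order_in_vertex oD'.
have vh : vertex (conj_set h std) by exists h.
have DE : D = conj_set h std.
  apply/(dist0 vD vh)/eqP; rewrite -leqn0; apply/dist_le => // q Dq.
  by rewrite expr0 scale1r; apply/D'h/DD'.
by apply/seteqP; split=> //; rewrite DE.
Qed.

(** With [D = End L], the new vertex is the endomorphism ring of [L + q L].  This
    lattice is stable under [q] by the Cayley-Hamilton theorem, and [rho] maps it
    into [L]. *)
Lemma branch_near D (q : M2) b rho (r : nat) : vertex D -> vge 0 b -> nu rho = r%:Z%:E ->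
  vge 0 (\tr q) -> vge 0 (\det q) -> D (b%:M + rho *: q) ->
  exists D', [/\ vertex D', D' q & (dist D D' <= r)%N].
Proof.
move=> [g ug ->] hb hrho ht hd; rewrite conj_setE // => Hq.
set q' := invmx g *m q *m g.
have {Hq} hq' : std (rho *: q').
  have E : invmx g *m (b%:M + rho *: q) *m g = b%:M + rho *: q'.
    by rewrite mulmxDr mulmxDl conjZ mul_mx_scalar -scalemxAl mulVmx // scalemx1.
  have := stdD Hq (stdZ (e := -b) _ std1); rewrite vgeN E => /(_ hb).
  by rewrite scaleNr scalemx1 addrAC subrr add0r.
have trq : \tr q' = \tr q by rewrite /q' mxtrace_mulC mulKVmx.
have deq : \det q' = \det q by rewrite /q' !det_mulmx mulrAC -det_mulmx mulVmx // det1 mul1r.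
move: trq deq; rewrite (mx2_eta q') mx2_tr mx2_det.
have : q' = mx2 (q' 0 0) (q' 0 1) (q' 1 0) (q' 1 1) by exact: mx2_eta.
move: hq' => /stdE; rewrite !scalemx2E.
move: (q' 0 0) (q' 0 1) (q' 1 0) (q' 1 1) => a b' c d [h1 h2 h3 h4] Eq trq deq.
have hr x : vge 0 (rho * x) -> vge (- r%:Z) x.
  move=> h; rewrite -[x](mulKf (nu_neq0 hrho)) mulrC; apply: (vge_div hrho).
  by rewrite addNr.
pose L x y := exists x0 y0 z w, [/\ vge 0 x0, vge 0 y0, vge 0 z & vge 0 w] /\
  (x = x0 + (a * z + b' * w) /\ y = y0 + (c * z + d * w)).
have LO x y : vge 0 x -> vge 0 y -> L x y.
  by move=> hx hy; exists x, y, 0, 0; rewrite !vge0 !mulr0 !addr0.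
have nr : - r%:Z <= 0 by rewrite oppr_le0.
have Lr x y : L x y -> vge (- r%:Z) x /\ vge (- r%:Z) y.
  move=> [x0 [y0 [z [w [[i1 i2 i3 i4] [-> ->]]]]]].
  split; apply: vgeD.
  - exact: vgeW nr i1.
  - by apply: vgeD; apply: vgeMr => //; apply: hr.
  - exact: vgeW nr i2.
  - by apply: vgeD; apply: vgeMr => //; apply: hr.
have [||||x1 [x0 [y0 [x1n y0n LE]]]] := @lattice_basis L (- r%:Z).
- move=> _ _ _ _ [x0 [y0 [z [w [[i1 i2 i3 i4] [-> ->]]]]]]
    [x1 [y1 [z1 [w1 [[j1 j2 j3 j4] [-> ->]]]]]].
  exists (x0 + x1), (y0 + y1), (z + z1), (w + w1).
  by split; [split; exact: vgeD | split; ring].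
- move=> e _ _ he [x0 [y0 [z [w [[i1 i2 i3 i4] [-> ->]]]]]].
  exists (e * x0), (e * y0), (e * z), (e * w).
  by split; [split; exact: vgeMl | split; ring].
- exact: Lr.
- move=> x y; have [n hn] := pi_absorbs x; have [m hm] := pi_absorbs y.
  by exists (maxn n m); apply: LO; [apply: hn; exact: leq_maxl|apply: hm; exact: leq_maxr].
set h := mx2 x1 x0 0 y0.
have uh : h \in unitmx by rewrite mx2_unit mulr0 subr0 mulf_neq0.
have ugh : g *m h \in unitmx by rewrite unitmx_mul ug.
exists (conj_set (g *m h) std); split; first by exists (g *m h).
- rewrite conj_setM // conj_setE // -/q'; apply: (lattice_endo x1n y0n LE) => x y.
  rewrite Eq !mx2E => -[u0 [v0 [z [w [[i1 i2 i3 i4] [-> ->]]]]]].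
  exists (- \det q * z), (- \det q * w), (u0 + \tr q * z), (v0 + \tr q * w).
  split; first by split; do ?apply: vgeD => //; apply: vgeMl; rewrite ?vgeN.
  by rewrite -trq -deq; split; ring.
apply/dist_le; [by exists g|by exists (g *m h)|].
move=> phi /(conj_setE _ _ ug) hphi; rewrite conj_setM // conj_setE // conjZ.
apply: (lattice_endo x1n y0n LE) => x y /Lr [hx hy].
move/stdE: hphi => [p1 p2 p3 p4]; rewrite !scalemx2E.
by apply: LO; apply: vgeD; rewrite -mulrA exprnP vge_pi sub0r; exact: vgeMl.
Qed.

(** * Walks *)

Lemma apt_walk g I : g \in unitmx -> is_walk nu pi I (apt g).
Proof.
move=> ug; split=> m *.
- by apply/maximal_orderE; exact: vertex_apt.
- apply/neighbors_dist; try exact: vertex_apt.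
  by rewrite dist_apt //; lia.
- move=> E; have : dist (apt g m) (apt g (m + 2)) = 0%N by rewrite -E dist_apt // subrr.
  by rewrite dist_apt //; lia.
Qed.

Lemma closer_neighbor D X : vertex D -> vertex X -> D <> X ->
  exists2 E, neighbors nu pi D E & (dist E X < dist D X)%N.
Proof.
move=> vD vX DX; have [g [ug E1 E2]] := common_apartment vD vX.
have d0 : dist D X <> 0%N by move/(dist0 vD vX).
exists (apt g 1); first by apply/neighborsE; exists g.
by rewrite {1}E2 dist_apt //; lia.
Qed.

(** Walks without backtracking are geodesics: at each step only one neighbor is
    closer to the start, and it is the previous vertex. *)
Lemma walk_prefix (I : set int) w (a : int) (n : nat) : is_walk nu pi I w -> (forall m, a <= m <= a + n%:Z -> I m) ->
  dist (w a) (w (a + n%:Z)) = n.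
Proof.
move=> [wv wn wb] HI.
have vw m : I m -> vertex (w m) by move=> /wv /maximal_orderE.
suff [] : dist (w a) (w (a + n%:Z)) = n /\
  ((0 < n)%N -> dist (w a) (w (a + n.-1%:Z)) = n.-1) by [].
elim: n HI => [|n IH] HI.
  by split=> //; rewrite addr0; apply/dist0 => //; apply: vw; apply: HI; lia.
have [|IH1 IH2] := IH; first by move=> m hm; apply: HI; lia.
split=> // {IH}.
have Ia : I a by apply: HI; lia.
have In : I (a + n%:Z) by apply: HI; lia.
have In1 : I (a + n%:Z + 1) by apply: HI; lia.
have E : a + n.+1%:Z = a + n%:Z + 1 by lia.
have va := vw _ Ia; have vn := vw _ In; have vn1 := vw _ In1.
have nb := wn _ In In1.
rewrite E dist_sym //.
have [->|h] := neighbor_cases va nb; first by rewrite dist_sym // IH1.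
exfalso; rewrite dist_sym // IH1 in h.
case: n h In In1 nb IH1 IH2 HI E vn vn1 => [//|n] h In In1 nb IH1 IH2 HI E vn vn1.
have En : a + n.+1%:Z = a + n%:Z + 1 by lia.
have In' : I (a + n%:Z) by apply: HI; lia.
have vn' := vw _ In'.
have E2 : a + n.+1%:Z + 1 = a + n%:Z + 2 by lia.
apply: (wb (a + n%:Z)) => //; first by rewrite -E2.
rewrite -E2; apply: (@closer_neighbor_uniq (w (a + n.+1%:Z)) _ _ (w a)) => //.
- by apply: neighbors_sym; rewrite En; apply: wn => //; rewrite -En.
- by rewrite dist_sym // (IH2 isT) dist_sym // IH1.
- by rewrite [dist (w (a + n.+1%:Z)) _]dist_sym // IH1; case: h => <-.
Qed.

Definition int_interval (I : set int) : Prop :=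
  forall a b m : int, I a -> I b -> a <= m <= b -> I m.

Lemma walk_domain_interval I : walk_domain I -> int_interval I /\ I 0.
Proof.
case=> [[n ->]|->|->]; split=> //= a b m; rewrite /segment /=; lia.
Qed.

Lemma walk_dist I w (a b : int) : int_interval I -> is_walk nu pi I w -> I a -> I b ->
  dist (w a) (w b) = absz (a - b).
Proof.
move=> HI hw.
have key x y : x <= y -> I x -> I y -> dist (w x) (w y) = absz (x - y).
  move=> xy Ix Iy; have [n En] : exists n : nat, y = x + n%:Z by exists (absz (y - x)); lia.
  rewrite En (walk_prefix hw); first by lia.
  by move=> m hm; apply: HI Ix Iy _; rewrite En.
move=> Ia Ib; case: (leP a b) => ab; first exact: key.
have [wv _ _] := hw.
rewrite dist_sym; try by apply/maximal_orderE; exact: wv.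
by rewrite key //; lia.
Qed.

Lemma tree_distE D D' n : tree_dist nu pi D D' n <->
  [/\ vertex D, vertex D' & dist D D' = n].
Proof.
split=> [[w [hw <- <-]]|[vD vD' <-]].
  have [HI I0] : int_interval (segment n) /\ segment n 0.
    by apply: walk_domain_interval; constructor 1; exists n.
  have In : segment n n%:Z by rewrite /segment /=; lia.
  have [wv _ _] := hw.
  split; try by apply/maximal_orderE; exact: wv.
  by rewrite (walk_dist HI hw) // sub0r abszN absz_nat.
have [g [ug E1 E2]] := common_apartment vD vD'.
by exists (apt g); split=> //; exact: apt_walk.
Qed.

Lemma ballE C p D : ball nu pi C p D <-> [/\ vertex C, vertex D & (dist C D <= p)%N].
Proof.
split=> [[n np /tree_distE [vC vD E]]|[vC vD h]]; first by split; rewrite ?E.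
by exists (dist C D) => //; apply/tree_distE.
Qed.

(** The residue field has at least two elements, so there are at least three
    neighbors. *)
Lemma third_neighbor D E1 E2 : vertex D ->
  exists E, [/\ neighbors nu pi D E, E <> E1 & E <> E2].
Proof.
move=> [g ug ->]; rewrite -apt0.
set D0 := apt g 0.
pose F1 := apt g 1; pose F2 := apt g (- 1); pose F3 := apt (g *m low2 1) (- 1).
have ul : g *m low2 1 \in unitmx by rewrite unitmx_mul ug low2_unit.
have El t : 0 <= t -> apt (g *m low2 1) t = apt g t by move=> t0; apply: apt_low => //; exact: vge1.
have v t h : h \in unitmx -> vertex (apt h t) by exact: vertex_apt.
have nF1 : neighbors nu pi D0 F1.
  by apply/neighbors_dist; rewrite /D0 /F1 ?dist_apt //; exact: v.
have nF2 : neighbors nu pi D0 F2.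
  by apply/neighbors_dist; rewrite /D0 /F2 ?dist_apt //; exact: v.
have nF3 : neighbors nu pi D0 F3.
  apply/neighbors_dist; [exact: v|exact: v|].
  by rewrite /D0 -El // dist_apt.
have ne A B n : vertex A -> dist A B = n.+1 -> A <> B.
  by move=> vA h E; move: h; rewrite -E (dist0 vA vA).2.
have n12 : F1 <> F2 by apply: (@ne _ _ 1%N); [exact: v | rewrite dist_apt].
have n13 : F1 <> F3.
  by apply: (@ne _ _ 1%N); [exact: v | rewrite /F1 -El // dist_apt].
have n23 : F2 <> F3.
  move=> E.
  have : F2 (g *m mx2 0 (pi ^ (- 1)) 0 0 *m invmx g).
    by apply/mem_apt => //; rewrite conjK // !mx2E !vge0 (vge_fin _ (nu_piz _)).
  rewrite E => /(mem_apt _ _ ul); rewrite invmx_mul ?low2_unit // low2_inv.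
  have -> (q : M2) : low2 (- 1) *m invmx g *m (g *m q *m invmx g) *m (g *m low2 1)
      = low2 (- 1) *m q *m low2 1.
    by rewrite !mulmxA -(mulmxA (low2 _)) mulVmx // mulmx1 mulmxKV.
  rewrite !mx2M !mx2E !(mul0r, mulr0, addr0, add0r, mulr1, mul1r) => -[h _ _ _].
  by move: h; rewrite (vge_fin _ (nu_piz _)).
case: (pselect (F1 <> E1 /\ F1 <> E2)) => [[h1 h2]|h1]; first by exists F1.
case: (pselect (F2 <> E1 /\ F2 <> E2)) => [[h2 h3]|h2]; first by exists F2.
exists F3; split=> // E; subst.
  have /contrapT e1 : ~ F1 <> E2 by move=> h; apply: h1; split.
  have /contrapT e2 : ~ F2 <> E2 by move=> h; apply: h2; split.
  by apply: n12; rewrite e1 e2.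
have /contrapT e1 : ~ F1 <> E1 by move=> h; apply: h1; split.
have /contrapT e2 : ~ F2 <> E1 by move=> h; apply: h2; split.
by apply: n12; rewrite e1 e2.
Qed.

(** Iterated [third_neighbor]: once a step increases the distance to [X], every
    further step without backtracking increases it. *)
Lemma prolong D E r : neighbors nu pi D E ->
  exists2 D', vertex D' & forall X, vertex X -> dist E X = (dist D X).+1 ->
    dist D' X = (dist D X + r.+1)%N.
Proof.
move=> DE.
suff [F [D' [nb H]]] : exists F D', neighbors nu pi F D' /\
    forall X, vertex X -> dist E X = (dist D X).+1 ->
      dist F X = (dist D X + r)%N /\ dist D' X = (dist D X + r.+1)%N.
  by exists D' => [|X vX /(H X vX) []]; first by have [] := neighbors_vertex nb.
elim: r => [|r [F [D' [nb H]]]].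
  by exists D, E; split=> // X vX ->; rewrite addn0 addn1.
have [vF vD'] := neighbors_vertex nb.
have [G [nG GF _]] := third_neighbor F F vD'.
exists D', G; split=> // X vX h; have [h1 h2] := H X vX h; split=> //.
have [->|h3] := neighbor_cases vX nG; first by rewrite h2 !addnS.
exfalso; apply: GF; apply: (closer_neighbor_uniq vX nG (neighbors_sym nb)).
  by rewrite h3.
by rewrite h1 h2 addnS.
Qed.

(** On the path, only the two adjacent vertices lead towards other vertices of the
    path.  Off the path, the same neighbor leads to all of it, since this neighbor
    does not change between consecutive vertices of the path.  A third neighbor
    does the job in both cases. *)
Lemma leave_path I w D : int_interval I -> I 0 -> is_walk nu pi I w -> vertex D ->
  exists2 E, neighbors nu pi D E & forall t, I t -> dist E (w t) = (dist D (w t)).+1.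
Proof.
move=> HI I0 hw vD; have [wv wn wb] := hw.
have vw t : I t -> vertex (w t) by move=> /wv /maximal_orderE.
case: (pselect (exists2 t, I t & w t = D)) => [[t0 It0 Et0]|nD].
  have [E [nE E1 E2]] := third_neighbor (w (t0 + 1)) (w (t0 - 1)) vD.
  exists E => // t It; have [//|h] := neighbor_cases (vw t It) nE; exfalso.
  have dD : dist D (w t) = absz (t0 - t) by rewrite -Et0 (walk_dist HI hw).
  case: (ltgtP t0 t) => tt0.
  - have It1 : I (t0 + 1) by apply: HI It0 It _; lia.
    apply: E1; apply: (closer_neighbor_uniq (vw t It) nE).
    + by rewrite -Et0; apply: wn.
    + by rewrite h.
    + by rewrite dD (walk_dist HI hw) //; lia.
  - have It1 : I (t0 - 1) by apply: HI It It0 _; lia.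
    apply: E2; apply: (closer_neighbor_uniq (vw t It) nE).
    + by apply: neighbors_sym; rewrite -Et0 -{2}(subrK 1 t0); apply: wn => //; rewrite subrK.
    + by rewrite h.
    + by rewrite dD (walk_dist HI hw) //; lia.
  - by move: h; rewrite dD tt0 subrr.
have neD t : I t -> D <> w t by move=> It E; apply: nD; exists t.
have [z nz hz] := closer_neighbor vD (vw _ I0) (neD _ I0).
have [_ vz] := neighbors_vertex nz.
have step t t' : I t -> I t' -> neighbors nu pi (w t) (w t') ->
    (dist z (w t) < dist D (w t))%N -> (dist z (w t') < dist D (w t'))%N.
  move=> It It' nb h.
  have d1 : dist (w t) (w t') = 1%N by apply/neighbors_dist => //; exact: vw.
  have := neighbor_cases vD nb; rewrite !(dist_sym (vw _ _) vD) // => -[h'|h'].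
    apply: leq_ltn_trans (dist_triangle vz (vw _ It) (vw _ It')) _.
    by rewrite d1 h' addn1 ltnS.
  have [z' nz' hz'] := closer_neighbor vD (vw _ It') (neD _ It').
  have [_ vz'] := neighbors_vertex nz'.
  suff -> : z = z' by [].
  apply: (closer_neighbor_uniq (vw _ It) nz nz') => //.
  apply: leq_ltn_trans (dist_triangle vz' (vw _ It') (vw _ It)) _.
  by rewrite (dist_sym (vw _ It') (vw _ It)) d1 h' addn1 ltnS.
have all_closer n : forall t, I t -> absz t = n -> (dist z (w t) < dist D (w t))%N.
  elim: n => [|n IH] t It ht; first by have -> : t = 0 by lia.
  case: (leP 0 t) => t0.
    have It' : I (t - 1) by apply: HI I0 It _; lia.
    apply: (step (t - 1)) => //; last by apply: IH => //; lia.
    by rewrite -{2}(subrK 1 t); apply: wn => //; rewrite subrK.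
  have It' : I (t + 1) by apply: HI It I0 _; lia.
  apply: (step (t + 1)) => //; last by apply: IH => //; lia.
  by apply: neighbors_sym; apply: wn.
have [E [nE Ez _]] := third_neighbor z z vD.
exists E => // t It; have [//|h] := neighbor_cases (vw t It) nE; exfalso.
apply: Ez; apply: (closer_neighbor_uniq (vw t It) nE nz); first by rewrite h.
exact: all_closer It erefl.
Qed.

Lemma escape I w D r : int_interval I -> I 0 -> is_walk nu pi I w -> vertex D ->
  exists D', [/\ vertex D', dist D D' = r &
    forall t, I t -> dist D' (w t) = (dist D (w t) + r)%N].
Proof.
move=> HI I0 hw vD; have [wv _ _] := hw.
case: r => [|r].
  by exists D; split=> // [|t _]; [apply/dist0 | rewrite addn0].
have [E nE hE] := leave_path HI I0 hw vD.
have [_ vE] := neighbors_vertex nE.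
have [D' vD' H] := prolong r nE; exists D'; split=> //.
  have dDD : dist D D = 0%N by apply/dist0.
  rewrite dist_sym // H ?dDD ?add0n //.
  by rewrite dist_sym //; apply/neighbors_dist.
by move=> t It; rewrite H ?hE //; apply/maximal_orderE; exact: wv.
Qed.

(** The depth is the largest radius of a ball contained in the thick path, and the
    stem consists of the centers of these balls, because [escape] leads out of the
    thick path from any other center or with any larger radius. *)
Lemma stem_uniq (S A B : set (set M2)) :
  is_stem nu pi S A -> is_stem nu pi S B -> A = B.
Proof.
have facts p I w (M : set (set M2)) : walk_domain I -> is_walk nu pi I w ->
    S = \bigcup_(t in I) ball nu pi (w t) p -> M = w @` I ->
    [/\ exists2 D, vertex D & forall D', vertex D' -> (dist D D' <= p)%N -> S D',
        forall D, vertex D ->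
          ~ (forall D', vertex D' -> (dist D D' <= p.+1)%N -> S D') &
        M = [set D | vertex D /\ forall D', vertex D' -> (dist D D' <= p)%N -> S D']].
  move=> /walk_domain_interval [HI I0] hw ES EM; have [wv _ _] := hw.
  have vw t : I t -> vertex (w t) by move=> /wv /maximal_orderE.
  have inS t D' : I t -> vertex D' -> (dist (w t) D' <= p)%N -> S D'.
    by move=> It vD' h; rewrite ES; exists t => //; apply/ballE; split=> //; exact: vw.
  split.
  - by exists (w 0); [exact: vw | move=> D'; exact: inS].
  - move=> D vD H; have [D' [vD' d1 d2]] := escape p.+1 HI I0 hw vD.
    have := H D' vD'; rewrite d1 leqnn ES => /(_ isT) [t It /ballE [vt _]].
    by rewrite dist_sym // d2 //; lia.
  - rewrite EM; apply/seteqP; split=> [_ [t It <-]|D [vD H]].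
      by split; [exact: vw | move=> D'; exact: inS].
    have [D' [vD' d1 d2]] := escape p HI I0 hw vD.
    have := H D' vD'; rewrite d1 leqnn ES => /(_ isT) [t It /ballE [vt _]].
    rewrite dist_sym // d2 // => h; exists t => //; apply/esym.
    by apply/(dist0 vD vt); lia.
move=> [p [I [w [d1 d2 d3 d4]]]] [p' [I' [w' [e1 e2 e3 e4]]]].
have [[D vD HD] A2 A3] := facts _ _ _ _ d1 d2 d3 d4.
have [[D' vD' HD'] B2 B3] := facts _ _ _ _ e1 e2 e3 e4.
case: (ltngtP p p') => pp.
- exfalso; apply: (A2 _ vD') => F vF h; apply: HD' => //.
  exact: leq_trans h pp.
- exfalso; apply: (B2 _ vD) => F vF h; apply: HD => //.
  exact: leq_trans h pp.
- by rewrite A3 B3 pp.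
Qed.

Lemma stemE q A : is_stem nu pi (branch nu q) A -> stem nu pi q = A.
Proof.
move=> h; rewrite /stem; case: xgetP => [B _ hB|/(_ A) //].
exact: stem_uniq hB h.
Qed.

(** * Branches of reduced elements *)

Lemma branchE q D : branch nu q D <-> vertex D /\ D q.
Proof. by rewrite /branch /= maximal_orderE. Qed.

Lemma tr_conj g (q : M2) : g \in unitmx -> \tr (invmx g *m q *m g) = \tr q.
Proof. by move=> ug; rewrite mxtrace_mulC mulKVmx. Qed.

Lemma det_conj g (q : M2) : g \in unitmx -> \det (invmx g *m q *m g) = \det q.
Proof. by move=> ug; rewrite !det_mulmx mulrAC -det_mulmx mulVmx // det1 mul1r. Qed.

Lemma branch_convex q g a b t : g \in unitmx -> branch nu q (apt g a) ->
  branch nu q (apt g b) -> a <= t <= b -> branch nu q (apt g t).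
Proof.
move=> ug /branchE [_ /(mem_apt _ _ ug) [h1 h2 h3 h4]].
move=> /branchE [_ /(mem_apt _ _ ug) [h5 h6 h7 h8]] /andP [h9 h10].
apply/branchE; split; first exact: vertex_apt.
apply/mem_apt => //; split=> //; first exact: vgeW h6.
by apply: vgeW h3; rewrite lerN2.
Qed.

Lemma branch_nonempty q : vge 0 (\tr q) -> vge 0 (\det q) ->
  exists g, g \in unitmx /\ branch nu q (apt g 0).
Proof.
move=> ht hd.
have [N hN] : exists N : nat, std (pi ^+ N *: q).
  have [a ha] := pi_absorbs (q 0 0); have [b hb] := pi_absorbs (q 0 1).
  have [c hc] := pi_absorbs (q 1 0); have [d hd'] := pi_absorbs (q 1 1).
  exists (a + b + c + d)%N; apply/stdE; rewrite !scalemx2E.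
  by split; [apply: ha|apply: hb|apply: hc|apply: hd']; clear; lia.
have vstd : vertex std by exists 1%:M; rewrite ?unitmx1 ?conj_set1.
have [|||D' [[g ug ED] Dq _]] := @branch_near std q 0 (pi ^+ N) N vstd _ _ ht hd.
- exact: vge0.
- by rewrite exprnP nu_piz.
- by rewrite (_ : 0%:M = 0) ?add0r //; apply/matrixP => i j; rewrite !mxE mul0rn.
by exists g; split=> //; apply/branchE; rewrite apt0 -ED; split=> //; exists g.
Qed.

(** These are the idempotents of rank one. *)
Definition split_elt (q : M2) : Prop := \tr q = 1 /\ \det q = 0.

Definition ramified_elt (q : M2) : Prop := vge 1 (\tr q) /\ nu (\det q) = 1%:E.

Definition inert_elt (q : M2) : Prop :=
  [/\ vge 0 (\tr q), vge 0 (\det q) &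
      forall r, vge 0 r -> ~~ vge 1 (r ^+ 2 - \tr q * r + \det q)].

(** The two base changes have a column of [q] and one of [1 - q] as
    columns; one of them is invertible. *)
Lemma split_diag q : split_elt q ->
  exists2 h, h \in unitmx & invmx h *m q *m h = mx2 1 0 0 0.
Proof.
move=> [ht hd]; have := ht; have := hd; rewrite (mx2_eta q) mx2_tr mx2_det.
move: (q 0 0) (q 0 1) (q 1 0) (q 1 1) => a b c d /eqP.
rewrite subr_eq0 => /eqP hdet htr.
have key (h : M2) : h \in unitmx -> mx2 a b c d *m h = h *m mx2 1 0 0 0 ->
    exists2 h, h \in unitmx & invmx h *m mx2 a b c d *m h = mx2 1 0 0 0.
  by move=> uh E; exists h => //; rewrite -mulmxA E mulKmx.
have Ed : d = 1 - a by rewrite -htr addrC addKr.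
case: (eqVneq a 0) => [a0|a0].
  apply: (key (mx2 b 1 d (- c))).
    by rewrite mx2_unit mulrN -hdet a0 mul0r oppr0 sub0r mul1r oppr_eq0 Ed a0 subr0 oner_neq0.
  have bc : b * c = 0 by rewrite -hdet a0 mul0r.
  rewrite !mx2M Ed a0; congr mx2; rewrite ?mul0r ?subr0 ?mulr1 ?mulr0 ?addr0 ?add0r ?mul1r //.
  - by rewrite mulrN bc oppr0.
  - by rewrite [c * b]mulrC bc add0r.
  - by rewrite subrr.
apply: (key (mx2 a (- b) c a)).
  rewrite mx2_unit mulNr opprK -hdet -mulrDr htr mulr1 //.
rewrite !mx2M; congr mx2; rewrite ?mulr0 ?mulr1 ?addr0.
- by rewrite -hdet -mulrDr htr mulr1.
- by rewrite mulrN [b * a]mulrC addNr.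
- by rewrite [c * a]mulrC -mulrDl htr mul1r.
- by rewrite mulrN [c * b]mulrC -hdet [d * a]mulrC addNr.
Qed.

(** In an eigenbasis, [diag(1, 0)] stabilizes a lattice only if the lattice is the
    sum of its intersections with the two axes. *)
Lemma branch_split q : split_elt q ->
  exists2 h, h \in unitmx & branch nu q = apt h @` setT.
Proof.
move=> /split_diag [h uh hq]; exists h => //; apply/seteqP; split=> D; last first.
  move=> [t _ <-]; apply/branchE; split; first exact: vertex_apt.
  by apply/mem_apt => //; rewrite hq !mx2E !vge0 vge1.
move=> /branchE [[g ug ->]].
have uhi : invmx h \in unitmx by rewrite unitmx_inv.
have um : invmx h *m g \in unitmx by rewrite unitmx_mul uhi.
rewrite -{1 2}(mulKVmx uh g) conj_setM // conj_setE // hq.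
move: (invmx h *m g) um => m um Hm.
suff [t Et] : exists t, conj_set m std = conj_set (dg t) std.
  by exists t => //; rewrite Et /apt conj_setM ?dg_unit.
have key a b c d : mx2 a b c d \in unitmx -> nu (a * d / (a * d - b * c)) = 0%E ->
    conj_set (mx2 a b c d) std (mx2 1 0 0 0) ->
    exists t, conj_set (mx2 a b c d) std = conj_set (dg t) std.
  move=> u1 h0; have := u1; rewrite mx2_unit; set e := _ - _ in h0 * => e0.
  rewrite conj_setE // mx2_inv // -/e !mx2M => /std_mx2 [_ i2 i3 _].
  have /eqP := nu_neq0 h0; have [-> |a0] := eqVneq a 0; first by rewrite !mul0r.
  have [-> |d0 _] := eqVneq d 0; first by rewrite mulr0 mul0r.
  have hb : vge 0 (b / a).
    rewrite (_ : b / a = (b * d / e) / (a * d / e)); last by field; rewrite a0 d0 e0.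
    apply: (vge_div h0); move: i2; rewrite addr0; congr (is_true (vge _ _)); ring.
  have hc : vge 0 (c / d).
    rewrite (_ : c / d = (a * c / e) / (a * d / e)); last by field; rewrite a0 d0 e0.
    apply: (vge_div h0); move: i3; rewrite addr0 -vgeN; congr (is_true (vge _ _)); ring.
  have [n hn] := nu_fin (mulf_neq0 a0 (negbT (etrans (invr_eq0 d) (negPf d0)))).
  have [eps heps Eeps] := piz_unit hn.
  exists n.
  have ge : GL2O (mx2 eps (eps * (b / a)) (c / d) 1).
    apply: GL2O_mx2; rewrite ?vge1 ?(vgeT heps) //.
      by apply: vgeMl => //; exact: vgeT.
    rewrite mulr1 (_ : eps - _ = eps * (a * d / e)^-1).
      by rewrite (nuM heps (nuV h0)).
    by rewrite /e; field; rewrite a0 d0 e0.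
  rewrite -[RHS](conj_mulGL2O (dg_unit n) ge) -[RHS](conj_setZ _ d0); last first.
    by rewrite unitmx_mul dg_unit; case: ge.
  congr conj_set; rewrite mx2M mx2Z !mul0r !addr0 !add0r !mul1r.
  have P0 := piz_neq0 n; have -> : eps = a / d / pi ^ n by rewrite Eeps mulrAC divff ?mul1r.
  by congr mx2; field; rewrite ?P0 ?a0 ?d0.
move: um Hm; rewrite (mx2_eta m).
move: (m 0 0) (m 0 1) (m 1 0) (m 1 1) => a b c d um Hm.
have := um; rewrite mx2_unit => e0.
have [i1 _ _ i4] : [/\ vge 0 (a * d / (a * d - b * c)), True, True &
    vge 0 (b * c / (a * d - b * c))].
  move: Hm; rewrite conj_setE // mx2_inv // !mx2M => /std_mx2 [i1 _ _ i4].
  split=> //; first by move: i1; congr (is_true (vge _ _)); ring.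
  by move: i4; rewrite -vgeN; congr (is_true (vge _ _)); ring.
case: (boolP (vge 1 (a * d / (a * d - b * c)))) => h1; last first.
  by apply: key => //; exact: int_unit.
have h2 : nu (b * c / (a * d - b * c)) = 0%E.
  apply: int_unit => //; apply/negP => h2.
  have : vge 1 1; last by rewrite (vge_fin _ nu1).
  have := vgeB h1 h2; congr (is_true (vge _ _)).
  by rewrite -mulrBl divff.
have Es : mx2 b a d c = mx2 a b c d *m swap2.
  by rewrite mx2M !mulr0 !mulr1 !add0r !addr0.
have Ec : conj_set (mx2 b a d c) std = conj_set (mx2 a b c d) std.
  by rewrite Es conj_mulGL2O //; exact: swap2_GL2O.
rewrite -Ec; apply: key; last by rewrite Ec.
  by rewrite Es unitmx_mul um swap2_unit.
rewrite -nuN -mulrN -invrN opprB; exact: h2.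
Qed.

(** A second vertex would give an eigenline modulo [pi], hence a root of the
    characteristic polynomial. *)
Lemma branch_inert q : inert_elt q ->
  exists2 h, h \in unitmx & branch nu q = apt h @` segment 0.
Proof.
move=> [ht hd hirr]; have [h [uh hb]] := branch_nonempty ht hd.
exists h => //; apply/seteqP; split=> D; last first.
  by move=> [t ht0 <-]; have -> : t = 0 by move: ht0; rewrite /segment /=; lia.
move=> /branchE [vD Dq].
case: (pselect (apt h 0 = D)) => [<-|neD].
  by exists 0 => //; rewrite /segment /=; lia.
exfalso; have v0 : vertex (apt h 0) by exact: vertex_apt.
have [g [ug E1 E2]] := common_apartment v0 vD.
have n0 : dist (apt h 0) D <> 0%N by move/(dist0 v0 vD).
have bD : branch nu q D by apply/branchE.
have : branch nu q (apt g 1).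
  rewrite E1 in hb; rewrite E2 in bD.
  by apply: (branch_convex ug hb bD); lia.
move=> /branchE [_ /(mem_apt _ _ ug)].
have := tr_conj q ug; have := det_conj q ug.
set m := _ *m g; rewrite {1 2}(mx2_eta m) mx2_det mx2_tr => hdm htm [i1 i2 i3 i4].
move: hb; rewrite E1 => /branchE [_ /(mem_apt _ _ ug)]; rewrite -/m => -[_ _ j3 _].
have := hirr _ i1; rewrite -hdm -htm.
rewrite (_ : _ + _ = - (m 0 1 * m 1 0)); last by ring.
by rewrite vgeN (vgeMr i2) // -[0]oppr0.
Qed.

(** Modulo [pi] the matrix is nilpotent, and it has an eigenline, which gives two
    adjacent vertices.  Two vertices at distance 2 would make the determinant
    divisible by [pi ^+ 2]. *)
Lemma branch_ramified q : ramified_elt q ->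
  exists2 h, h \in unitmx & branch nu q = apt h @` segment 1.
Proof.
move=> [ht hd].
have ht0 : vge 0 (\tr q) by exact: vgeW ht.
have hd0 : vge 0 (\det q) by rewrite (vge_fin _ hd).
have far D D' : branch nu q D -> branch nu q D' -> (dist D D' <= 1)%N.
  move=> bD bD'; rewrite leqNgt; apply/negP => lt.
  have [vD _] := (branchE _ _).1 bD; have [vD' _] := (branchE _ _).1 bD'.
  have [g [ug E1 E2]] := common_apartment vD vD'.
  have : branch nu q (apt g 2).
    rewrite E1 in bD; rewrite E2 in bD'.
    by apply: (branch_convex ug bD bD'); lia.
  move=> /branchE [_ /(mem_apt _ _ ug)].
  have := tr_conj q ug; have := det_conj q ug.
  set m := _ *m g; rewrite {1 2}(mx2_eta m) mx2_det mx2_tr => hdm htm [i1 i2 i3 i4].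
  move: bD; rewrite E1 => /branchE [_ /(mem_apt _ _ ug)]; rewrite -/m oppr0 => -[_ _ j3 _].
  have h2 : vge 2 (m 0 1 * m 1 0) by exact: vgeMr.
  have h1 : vge 1 (m 0 0 * m 1 1).
    rewrite -[m 0 0 * _](subrK (m 0 1 * m 1 0)) hdm; apply: vgeD; last exact: vgeW h2.
    by rewrite (vge_fin _ hd).
  have [a1 d1] : vge 1 (m 0 0) /\ vge 1 (m 1 1).
    have [h3|h3] := vge1M i1 i4 h1; split=> //.
      by rewrite -[m 1 1](addKr (m 0 0)) htm addrC; apply: vgeB.
    by rewrite -[m 0 0](addrK (m 1 1)) htm; apply: vgeB.
  have : vge 2 (\det q) by rewrite -hdm; apply: vgeB => //; exact: (vgeM a1 d1).
  by rewrite (vge_fin _ hd).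
have [h [uh hb]] := branch_nonempty ht0 hd0.
have [g [ug b0 b1]] : exists g, [/\ g \in unitmx, branch nu q (apt g 0) & branch nu q (apt g 1)].
  have := hb; move=> /branchE [_ /(mem_apt _ _ uh)].
  have := tr_conj q uh; have := det_conj q uh.
  set m := _ *m h; rewrite {1 2}(mx2_eta m) mx2_det mx2_tr oppr0 => hdm htm [i1 i2 i3 i4].
  case: (boolP (vge 1 (m 0 1))) => hb1.
    exists h; split=> //; apply/branchE; split; first exact: vertex_apt.
    by apply/mem_apt => //; rewrite -/m; split=> //; exact: vgeW i3.
  have ub := int_unit i2 hb1; have nb := nu_neq0 ub.
  (* modulo pi, the vector (1, y) spans the kernel of m *)
  pose y := - m 0 0 / m 0 1.
  have hy : vge 0 y by apply: (vge_div ub); rewrite addr0 vgeN.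
  have ul : h *m low2 y \in unitmx by rewrite unitmx_mul uh low2_unit.
  have ul' : h *m low2 y *m swap2 \in unitmx by rewrite unitmx_mul ul swap2_unit.
  have E0 : apt (h *m low2 y) 0 = apt h 0 by exact: apt_low.
  exists (h *m low2 y *m swap2); rewrite !apt_rev // oppr0 E0; split=> //.
  apply/branchE; split; first exact: vertex_apt.
  apply/mem_apt => //; rewrite invmx_mul ?low2_unit // low2_inv.
  rewrite (_ : low2 (- y) *m invmx h *m q *m (h *m low2 y) = low2 (- y) *m m *m low2 y);
    last by rewrite /m !mulmxA.
  rewrite {1 2 3 4}(mx2_eta m) !mx2M !mx2E !(mul0r, mulr0, addr0, add0r, mulr1, mul1r) opprK.
  split.
  - by apply: vgeD => //; exact: vgeMl.
  - by apply: vgeW i2.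
  - rewrite (_ : _ + _ = - (m 0 0 * m 1 1 - m 0 1 * m 1 0) / m 0 1); last by rewrite /y; field.
    by apply: (vge_div ub); rewrite addr0 vgeN hdm (vge_fin _ hd).
  - by apply: vgeD => //; apply: vgeMl => //; rewrite vgeN.
exists g => //; apply/seteqP; split=> D; last first.
  move=> [t]; rewrite /segment /= => ht1 <-.
  by have [->|->] : t = 0 \/ t = 1 by lia.
move=> bD; have [vD _] := (branchE _ _).1 bD.
have v0 : vertex (apt g 0) by exact: vertex_apt.
have v1 : vertex (apt g 1) by exact: vertex_apt.
case: (pselect (apt g 0 = D)) => [<-|n0]; first by exists 0; rewrite // /segment /=; lia.
case: (pselect (apt g 1 = D)) => [<-|n1]; first by exists 1; rewrite // /segment /=; lia.
exfalso.
have d0 : dist (apt g 0) D = 1%N.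
  have := far _ _ b0 bD; case E : (dist (apt g 0) D) => [|[|n]] // _.
  by case: n0; apply/(dist0 v0 vD).
have d1 : dist (apt g 1) D = 1%N.
  have := far _ _ b1 bD; case E : (dist (apt g 1) D) => [|[|n]] // _.
  by case: n1; apply/(dist0 v1 vD).
have nb : neighbors nu pi (apt g 0) (apt g 1).
  by apply/neighbors_dist => //; rewrite dist_apt.
by have [] := neighbor_cases vD nb; rewrite d0 d1.
Qed.

(** These are the generators of the maximal orders of the quadratic etale
    subalgebras; [I] indexes the walk formed by the branch. *)
Definition reduced_elt (q : M2) (I : set int) : Prop :=
  [\/ split_elt q /\ I = setT, ramified_elt q /\ I = segment 1 | inert_elt q /\ I = segment 0].

Lemma reduced_integral q I : reduced_elt q I -> vge 0 (\tr q) /\ vge 0 (\det q).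
Proof.
case=> [[[-> ->] _]|[[h1 h2] _]|[[h1 h2 _] _]]; split=> //; rewrite ?vge1 ?vge0 //.
  exact: vgeW h1.
by rewrite (vge_fin _ h2).
Qed.

Lemma branch_reduced q I : reduced_elt q I ->
  exists2 h, h \in unitmx & branch nu q = apt h @` I.
Proof.
case=> [[h ->]|[h ->]|[h ->]]; first exact: branch_split.
  exact: branch_ramified.
exact: branch_inert.
Qed.

Lemma reduced_domain q I : reduced_elt q I -> walk_domain I.
Proof.
case=> [[_ ->]|[_ ->]|[_ ->]]; first by constructor 3.
  by constructor 1; exists 1%N.
by constructor 1; exists 0%N.
Qed.

Lemma stem_reduced q I b rho (r : nat) : reduced_elt q I -> vge 0 b -> nu rho = r%:Z%:E ->
  stem nu pi (b%:M + rho *: q) = branch nu q.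
Proof.
move=> hq hb hrho; apply: stemE.
have [h uh E] := branch_reduced hq; have [ht hd] := reduced_integral hq.
exists r, I, (apt h); split=> //; first exact: reduced_domain hq.
  exact: apt_walk.
apply/seteqP; split=> D.
  move=> /branchE [vD Dq].
  have [D' [vD' D'q dd]] := branch_near vD hb hrho ht hd Dq.
  have : branch nu q D' by apply/branchE.
  rewrite E => -[t It Et]; exists t => //; apply/ballE; rewrite Et; split=> //.
  by rewrite dist_sym.
move=> [t It /ballE [vt vD /(dist_le _ vt vD) dd]]; apply/branchE; split=> //.
have : branch nu q (apt h t) by rewrite E; exists t.
move=> /branchE [_ /dd]; rewrite exprnP.
have [g ug ->] := vD; rewrite !conj_setE // conjZ => hs.
rewrite mulmxDr mulmxDl conjZ mul_mx_scalar -scalemxAl mulVmx // scalemx1.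
apply: stdD; first by rewrite -scalemx1; apply: stdZ => //; exact: std1.
have [eps heps ->] := piz_unit hrho.
by rewrite mulrC -scalerA; apply: stdZ => //; exact: vgeT.
Qed.

(** * Lengths *)

Lemma edges_segment g n : g \in unitmx -> edges nu pi (apt g @` segment n) #= `I_n.
Proof.
move=> ug; pose f (t : nat) : set (set M2) := [set apt g t%:Z; apt g (t%:Z + 1)].
have inj a b : apt g a = apt g b -> a = b.
  move=> E; have := dist_apt a b ug; rewrite E dist_apt // subrr => h.
  by apply/eqP; rewrite -subr_eq0 -absz_eq0 -h.
have v t : vertex (apt g t) by exact: vertex_apt.
suff -> : edges nu pi (apt g @` segment n) = f @` `I_n.
  apply: inj_card_eq => s t _ _ E.
  have : f t (apt g s%:Z) by rewrite -E; left.
  have : f t (apt g (s%:Z + 1)) by rewrite -E; right.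
  by rewrite /f /= => -[/inj h1|/inj h1] [/inj h2|/inj h2]; lia.
apply/seteqP; split=> [e [_ [_ [[a ha <-] [b hb <-]]]]|_ [t ht <-]].
  move=> /(neighbors_dist (v a) (v b)); rewrite dist_apt // => ab ->.
  move: ha hb; rewrite /segment /= => ha hb.
  have [E|E] : b = a + 1 \/ a = b + 1 by lia.
    by exists (absz a); rewrite /= ?E /f; [lia | congr [set apt g _; apt g _]; lia].
  exists (absz b); rewrite /= ?E /f; first by lia.
  rewrite setUC; congr [set apt g _; apt g _]; lia.
move: ht => /= ht; exists (apt g t%:Z), (apt g (t%:Z + 1)); split=> //.
- by exists t%:Z => //; rewrite /segment /=; lia.
- by exists (t%:Z + 1) => //; rewrite /segment /=; lia.
- by apply/(neighbors_dist (v _) (v _)); rewrite dist_apt //; lia.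
Qed.

Lemma length_segment g n : g \in unitmx ->
  graph_length nu pi (apt g @` segment n) = n%:R%:E.
Proof.
move=> ug; have h := edges_segment n ug; rewrite /graph_length.
case: asboolP => [_|[]]; first by rewrite (card_fset_set h).
by apply/finite_setP; exists n.
Qed.

Definition subtree (A : set (set M2)) : Prop :=
  (forall D, A D -> vertex D) /\
  forall g a b t, g \in unitmx -> A (apt g a) -> A (apt g b) -> a <= t <= b -> A (apt g t).

Lemma length_unbounded A : subtree A ->
  (forall n : nat, exists D D', [/\ A D, A D' & (n <= dist D D')%N]) ->
  graph_length nu pi A = +oo%E.
Proof.
move=> [Av Ac] Au; rewrite /graph_length; case: asboolP => // fin; exfalso.
set N := #|` fset_set (edges nu pi A)|%fset.
have [D [D' [AD AD' hN]]] := Au N.+1.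
have [g [ug E1 E2]] := common_apartment (Av _ AD) (Av _ AD').
have sub : edges nu pi (apt g @` segment N.+1) `<=` edges nu pi A.
  have inA t : segment N.+1 t -> A (apt g t).
    rewrite /segment /= => ht; rewrite E1 in AD; rewrite E2 in AD'.
    by apply: (Ac g _ _ t ug AD AD'); lia.
  by move=> e [_ [_ [[a /inA ha <-] [b /inA hb <-] nb ->]]]; exists (apt g a), (apt g b).
have : (N.+1 <= N)%N; last by rewrite ltnn.
apply: leq_card_fset_set => //.
by rewrite -(card_le_eql (edges_segment N.+1 ug)); exact: subset_card_le.
Qed.

Lemma bounded_subtree A h L : h \in unitmx -> subtree A -> A `<=` apt h @` setT ->
  (exists D D', [/\ A D, A D' & dist D D' = L]) ->
  (forall D D', A D -> A D' -> (dist D D' <= L)%N) ->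
  exists g, [/\ g \in unitmx, A = apt g @` segment L, A (apt g 0) & A (apt g L%:Z)].
Proof.
move=> uh [Av Ac] sub [D [D' [AD AD' dL]]] Amax.
have [a [b [ab Aa Ab]]] : exists a b : int, [/\ b = a + L%:Z, A (apt h a) & A (apt h b)].
  have [x _ Ex] := sub _ AD; have [y _ Ey] := sub _ AD'.
  move: dL AD AD'; rewrite -Ex -Ey dist_apt // => dL AD AD'.
  by case: (leP x y) => xy; [exists x, y | exists y, x]; split=> //; lia.
have ug : h *m dg a \in unitmx by rewrite unitmx_mul uh dg_unit.
exists (h *m dg a); rewrite !apt_shift addr0 -ab; split=> //.
apply/seteqP; split=> [X AX|_ [t ht <-]].
  have [c _ Ec] := sub _ AX; rewrite -Ec in AX.
  have := Amax _ _ AX Aa; have := Amax _ _ AX Ab; rewrite !dist_apt // => h1 h2.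
  by exists (c - a); [rewrite /segment /=; lia | rewrite apt_shift -Ec; congr apt; lia].
move: ht; rewrite /segment /= apt_shift => ht.
by apply: (Ac h a b) => //; lia.
Qed.

Lemma subtree_branch q : subtree (branch nu q).
Proof.
split=> [D /branchE [] //|g a b t ug ha hb]; exact: branch_convex.
Qed.

Lemma subtreeI A B : subtree A -> subtree B -> subtree (A `&` B).
Proof.
move=> [Av Ac] [Bv Bc]; split=> [D [/Av]//|g a b t ug [Aa Ba] [Ab Bb] h].
by split; [apply: Ac Ab h | apply: Bc Bb h].
Qed.

Definition has_distance (A : set (set M2)) (n : nat) : Prop :=
  exists D D', [/\ A D, A D' & dist D D' = n].

Lemma reduced_length q I : reduced_elt q I ->
  (I = setT /\ graph_length nu pi (branch nu q) = +oo%E /\ forall n, has_distance (branch nu q) n) \/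
  exists n : nat, [/\ (n <= 1)%N, graph_length nu pi (branch nu q) = n%:R%:E,
    has_distance (branch nu q) n & forall D D', branch nu q D -> branch nu q D' -> (dist D D' <= n)%N].
Proof.
move=> hq; have [h uh E] := branch_reduced hq.
have seg n : I = segment n -> [/\ graph_length nu pi (branch nu q) = n%:R%:E,
    has_distance (branch nu q) n & forall D D', branch nu q D -> branch nu q D' -> (dist D D' <= n)%N].
  move=> EI; rewrite E EI; split; first exact: length_segment.
    exists (apt h 0), (apt h n%:Z); split.
    - by exists 0 => //; rewrite /segment /=; lia.
    - by exists n%:Z => //; rewrite /segment /=; lia.
    - by rewrite dist_apt //; lia.
  move=> _ _ [a ha <-] [b hb <-]; rewrite dist_apt //.
  by move: ha hb; rewrite /segment /=; lia.
case: hq => -[_ EI].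
- left; split=> //.
  have le n : has_distance (branch nu q) n.
    rewrite E EI; exists (apt h 0), (apt h n%:Z); split; [by exists 0|by exists n%:Z|].
    by rewrite dist_apt //; lia.
  split=> //; apply: length_unbounded; first exact: subtree_branch.
  by move=> n; have [D [D' [h1 h2 h3]]] := le n; exists D, D'; rewrite h3.
- by right; exists 1%N; have [h1 h2 h3] := seg _ EI.
- by right; exists 0%N; have [h1 h2 h3] := seg _ EI.
Qed.

Lemma reduced_length_set q I : reduced_elt q I ->
  [set 0%E; 1%:E; +oo%E] (graph_length nu pi (branch nu q)).
Proof.
move=> /reduced_length [[_ [-> _]]|[n [hn -> _ _]]]; first by right.
by left; case: n hn => [|[|n]] // _; [left|right].
Qed.

(** * The determinant of the commutator *)

Definition comm2 (A B : M2) : M2 := A *m B - B *m A.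

Lemma conjM g (A B : M2) : g \in unitmx ->
  invmx g *m (A *m B) *m g = (invmx g *m A *m g) *m (invmx g *m B *m g).
Proof. by move=> ug; rewrite !mulmxA mulmxK. Qed.

Lemma det_comm2 a b c d a' b' c' d' :
  \det (comm2 (mx2 a b c d) (mx2 a' b' c' d')) =
  - (b * c' - b' * c) ^+ 2
  - ((a - d) * b' - b * (a' - d')) * (c * (a' - d') - c' * (a - d)).
Proof. by rewrite /comm2 !mx2M mx2N mx2D mx2_det; ring. Qed.

Lemma det_comm2_conj g (A B : M2) : g \in unitmx ->
  \det (comm2 A B) = \det (comm2 (invmx g *m A *m g) (invmx g *m B *m g)).
Proof.
move=> ug; rewrite -(det_conj (comm2 A B) ug); congr (\det _).
by rewrite /comm2 mulmxBr mulmxBl !conjM.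
Qed.

(** In the apartment through two closest vertices, [apt g 0] and [apt g n], the
    matrix [A] does not belong to [apt g 1], nor [B] to [apt g (n - 1)].  This
    fixes the valuations of the entry [A 0 1] and of the entry [B 1 0], whose
    product dominates the diagonal of the commutator. *)
Lemma disjoint_branches A B I J : reduced_elt A I -> reduced_elt B J ->
  branch nu A `&` branch nu B = set0 ->
  exists n : nat, [/\ (0 < n)%N, nu (\det (comm2 A B)) = (- (2 * n%:Z))%:E &
    subgraph_dist nu pi (branch nu A) (branch nu B) n].
Proof.
move=> hA hB disj.
pose P n := `[< exists D D', [/\ branch nu A D, branch nu B D' & dist D D' = n] >].
have exP : exists n, P n.
  have [t1 d1] := reduced_integral hA; have [t2 d2] := reduced_integral hB.
  have [g [ug h1]] := branch_nonempty t1 d1; have [h [uh h2]] := branch_nonempty t2 d2.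
  by exists (dist (apt g 0) (apt h 0)); apply/asboolP; exists (apt g 0), (apt h 0).
case: (ex_minnP exP) => n /asboolP [D [D' [AD BD' dn]]] nmin.
have [vD _] := (branchE _ _).1 AD; have [vD' _] := (branchE _ _).1 BD'.
have [g [ug E1 E2]] := common_apartment vD vD'; rewrite dn in E2.
have n0 : (0 < n)%N.
  rewrite lt0n; apply/eqP => z.
  have : (branch nu A `&` branch nu B) D by split=> //; rewrite (_ : D = D') // E1 E2 z.
  by rewrite disj.
exists n; split=> //; last first.
  split; first by exists D, D'; split=> //; apply/tree_distE.
  by move=> X X' m AX BX' /tree_distE [_ _ h]; apply: nmin; apply/asboolP; exists X, X'.
have nA : ~ branch nu A (apt g 1).
  move=> A1; have : P n.-1; last by move/nmin; lia.
  by apply/asboolP; exists (apt g 1), D'; split=> //; rewrite E2 dist_apt //; lia.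
have nB : ~ branch nu B (apt g (n%:Z - 1)).
  move=> B1; have : P n.-1; last by move/nmin; lia.
  by apply/asboolP; exists D, (apt g (n%:Z - 1)); split=> //; rewrite E1 dist_apt //; lia.
rewrite (det_comm2_conj A B ug).
have [_ /(mem_apt _ _ ug)] : vertex (apt g 0) /\ apt g 0 A by apply/branchE; rewrite -E1.
have [_ /(mem_apt _ _ ug)] : vertex (apt g n%:Z) /\ apt g n%:Z B by apply/branchE; rewrite -E2.
have {}nA : ~ apt g 1 A.
  by move=> h; apply: nA; apply/branchE; split=> //; exact: vertex_apt.
have {}nB : ~ apt g (n%:Z - 1) B.
  by move=> h; apply: nB; apply/branchE; split=> //; exact: vertex_apt.
move: nA nB; rewrite !mem_apt //.
set A' := _ *m g; set B' := _ *m g; rewrite (mx2_eta A') (mx2_eta B') det_comm2 !mx2E.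
move: (A' 0 0) (A' 0 1) (A' 1 0) (A' 1 1) (B' 0 0) (B' 0 1) (B' 1 0) (B' 1 1).
clear -hv hpi n0 => a b c d a' b' c' d' nA nB [j1 j2 j3 j4] [i1 i2 i3 i4]; rewrite oppr0 in i3.
have ub : nu b = 0%E.
  by apply: int_unit => //; apply/negP => h; apply: nA; split=> //; apply: vgeW i3; lia.
have uc' : nu c' = (- n%:Z)%:E.
  apply: vge_eq => //; apply/negP => h; apply: nB; split=> //.
    by apply: vgeW j2; lia.
  by apply: vgeW h; lia.
have hx : nu (b * c' - b' * c) = (- n%:Z)%:E.
  apply: nuD; first by rewrite (nuM ub uc'); congr (_%:E); lia.
  by rewrite vgeN; apply: vgeMr => //; apply: vgeW j2; clear -n0; lia.
have ha : vge 0 (a - d) by exact: vgeB.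
have ha' : vge 0 (a' - d') by exact: vgeB.
rewrite -opprD nuN; apply: nuD.
  by rewrite (nuXn 2 hx); congr (_%:E); clear; lia.
have h1 : vge 0 ((a - d) * b' - b * (a' - d')).
  apply: vgeB; [apply: (vgeMl ha) | exact: (vgeMl (vgeT ub) ha')].
  by apply: vgeW j2; clear; lia.
have h2 : vge (- n%:Z) (c * (a' - d') - c' * (a - d)).
  apply: vgeB; [apply: vgeMr ha' | exact: (vgeMr j3 ha)].
  by apply: vgeW i3; clear; lia.
by apply: vgeW (vgeM h1 h2); clear -n0; lia.
Qed.

(** In coordinates, the entries of [A] and [B] at [(0, 1)] are divisible by
    [pi ^+ L], and the determinant lies in the ideal that they generate. *)
Lemma common_path A B g (L : nat) : g \in unitmx ->
  apt g 0 A -> apt g 0 B -> apt g L%:Z A -> apt g L%:Z B ->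
  vge L%:Z (\det (comm2 A B)).
Proof.
move=> ug; rewrite (det_comm2_conj A B ug) !mem_apt //.
set A' := _ *m g; set B' := _ *m g; rewrite (mx2_eta A') (mx2_eta B') det_comm2 !mx2E.
move=> [i1 _ i3 i4] [j1 _ j3 j4] [_ i2 _ _] [_ j2 _ _]; rewrite oppr0 in i3 j3.
have ha : vge 0 (A' 0 0 - A' 1 1) by exact: vgeB.
have hb : vge 0 (B' 0 0 - B' 1 1) by exact: vgeB.
apply: vgeB.
  rewrite vgeN expr2; apply: vgeMr.
    by apply: vgeB; apply: vgeMr.
  by apply: vgeW (vgeB (vgeMr i2 j3) (vgeMr j2 i3)).
by apply: vgeMr; apply: vgeB; [exact: vgeMl|exact: vgeMr|exact: vgeMr|exact: vgeMr].
Qed.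

(** The hypothesis says that the vector [(1, y)] spans an eigenline of [m] modulo
    [pi]. *)
Lemma extend_low q g y (m := invmx g *m q *m g) : g \in unitmx -> apt g 0 q -> vge 0 y ->
  vge 1 (m 1 0 - (m 0 0 - m 1 1) * y - y ^+ 2 * m 0 1) -> apt (g *m low2 y) (- 1) q.
Proof.
move=> ug h0 hy h1.
have ul : g *m low2 y \in unitmx by rewrite unitmx_mul ug low2_unit.
have := h0; rewrite -(apt_low ug hy (lexx 0)).
rewrite !mem_apt //; set m' := _ *m (g *m low2 y).
have -> : m' = low2 (- y) *m m *m low2 y.
  by rewrite /m' /m invmx_mul ?low2_unit // low2_inv !mulmxA.
rewrite (mx2_eta m) !mx2M !mx2E => -[i1 i2 i3 i4]; split=> //; first exact: vgeW i2.
by move: h1; congr (is_true (vge _ _)); ring.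
Qed.

Lemma extend_upp q g x (s : int) (m := invmx g *m q *m g) : g \in unitmx -> 0 <= s ->
  apt g 0 q -> vge s x ->
  vge (s + 1) (m 0 1 + (m 0 0 - m 1 1) * x - x ^+ 2 * m 1 0) -> apt (g *m upp2 x) (s + 1) q.
Proof.
move=> ug s0 h0 hx h1.
have ul : g *m upp2 x \in unitmx by rewrite unitmx_mul ug upp2_unit.
have hx0 : vge 0 x by exact: vgeW hx.
have := h0; rewrite -(apt_upp ug hx0 hx s0).
rewrite !mem_apt //; set m' := _ *m (g *m upp2 x).
have -> : m' = upp2 (- x) *m m *m upp2 x.
  by rewrite /m' /m invmx_mul ?upp2_unit // upp2_inv !mulmxA.
rewrite (mx2_eta m) !mx2M !mx2E => -[i1 i2 i3 i4]; split=> //; last by apply: vgeW i3; lia.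
by move: h1; congr (is_true (vge _ _)); ring.
Qed.

(** Modulo [pi], the vector [(a - d, c)] is an eigenvector of the first matrix, as
    [b] vanishes, and the determinant of the commutator vanishes iff it is also an
    eigenvector of the second one.  The slope of a common line is [y = c / (a - d)];
    it is finite, because [(0, 1)] is not an eigenvector of the second matrix. *)
Lemma no_common_eigenline a b c d a' b' c' d' :
  vge 0 a -> vge 1 b -> vge 0 c -> vge 0 d ->
  vge 0 a' -> nu b' = 0%E -> vge 0 c' -> vge 0 d' ->
  ~ [/\ vge 1 (a - d), vge 1 b & vge 1 c] ->
  (forall y, vge 0 y -> vge 1 (c - (a - d) * y - y ^+ 2 * b) ->
     ~ vge 1 (c' - (a' - d') * y - y ^+ 2 * b')) ->
  ~ vge 1 (\det (comm2 (mx2 a b c d) (mx2 a' b' c' d'))).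
Proof.
move=> ha hb hc hd ha' hb' hc' hd' ns H; rewrite det_comm2.
have hb0 : vge 0 b by exact: vgeW hb.
have vb' : vge 0 b' by exact: vgeT.
have i1 : vge 0 (a - d) by exact: vgeB.
have i2 : vge 0 (a' - d') by exact: vgeB.
set e := a - d in i1 ns H *; set e' := a' - d' in i2 H *.
pose Q := b' * c ^+ 2 + e' * c * e - c' * e ^+ 2.
rewrite (_ : _ - _ = b * (2 * (b' * c * c') - b * c' ^+ 2 + e' * (c * e' - c' * e)) - b' * Q);
  last by rewrite /Q; ring.
move=> h.
have hQ : vge 1 Q.
  rewrite -[Q](mulKf (nu_neq0 hb')) mulrC; apply: (vge_div hb'); rewrite addr0.
  rewrite -(subKr (b * (2 * (b' * c * c') - b * c' ^+ 2 + e' * (c * e' - c' * e))) (b' * Q)).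
  apply: vgeB => //; apply: vgeMr => //.
  have j1 : vge 0 (2 * (b' * c * c')).
    by apply: vgeMl; [exact: vge_nat | do 2?apply: vgeMl].
  have j2 : vge 0 (b * c' ^+ 2) by apply: vgeMl => //; exact: vgeX.
  have j3 : vge 0 (c * e' - c' * e) by apply: vgeB; apply: vgeMl.
  by apply: vgeD; [exact: vgeB | exact: vgeMl].
case: (boolP (vge 1 e)) => he.
  apply: ns; split=> //.
  have : vge 1 (c * c).
    rewrite -[c * c](mulKf (nu_neq0 hb')) mulrC; apply: (vge_div hb'); rewrite addr0.
    rewrite (_ : _ * _ = Q - e * (e' * c - c' * e)); last by rewrite /Q; ring.
    apply: vgeB => //; apply: vgeMr => //.
    by apply: vgeB; apply: vgeMl.
  by case/(vge1M hc hc).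
have ue := int_unit i1 he; have e0 := nu_neq0 ue.
have hy : vge 0 (c / e) by apply: (vge_div ue); rewrite addr0.
have y2 : vge 0 ((c / e) ^+ 2) by exact: vgeX.
apply: (H _ hy).
  rewrite (_ : _ - _ = - ((c / e) ^+ 2 * b)); last by field.
  by rewrite vgeN; apply: vgeMl.
rewrite (_ : _ - _ = - Q / e ^+ 2); last by rewrite /Q; field.
by apply: (vge_div (nuXn 2 ue)); rewrite mul0r addr0 vgeN.
Qed.

Lemma split_disc q : split_elt q ->
  (q 0 0 - q 1 1) ^+ 2 = 1 - 4 * (q 0 1 * q 1 0).
Proof.
rewrite /split_elt {1 2}(mx2_eta q) mx2_tr mx2_det => -[ht hd].
rewrite (_ : _ ^+ 2 = (q 0 0 + q 1 1) ^+ 2 - 4 * (q 0 0 * q 1 1 - q 0 1 * q 1 0)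
  - 4 * (q 0 1 * q 1 0)); last by ring.
by rewrite ht hd expr1n mulr0 subr0.
Qed.

Lemma split_disc_unit q : split_elt q -> vge 0 (q 0 0) -> vge 0 (q 1 1) ->
  vge 1 (q 0 1 * q 1 0) -> nu (q 0 0 - q 1 1) = 0%E.
Proof.
move=> sq h1 h2 h3; have hd := vgeB h1 h2.
apply: int_unit => //; apply/negP => h.
have : vge 1 1; last by rewrite (vge_fin _ nu1).
rewrite (_ : 1 = (q 0 0 - q 1 1) ^+ 2 + 4 * (q 0 1 * q 1 0)).
  by apply: vgeD; [rewrite expr2; exact: vgeMl | apply: vgeMl => //; exact: vge_nat].
by rewrite (split_disc sq) subrK.
Qed.

(** Scalar modulo [pi] means discriminant in [pi], which excludes the split case,
    and in the ramified case a determinant divisible by [pi ^+ 2]. *)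
Lemma reduced_not_scalar q : split_elt q \/ ramified_elt q -> std q ->
  ~ [/\ vge 1 (q 0 0 - q 1 1), vge 1 (q 0 1) & vge 1 (q 1 0)].
Proof.
move=> hq /stdE [h1 h2 h3 h4] [i1 i2 i3]; case: hq => hq.
  have := split_disc_unit hq h1 h4 (vgeMr i2 h3).
  by move=> /vge_nS; rewrite add0r i1.
move: hq; rewrite /ramified_elt {1 2}(mx2_eta q) mx2_tr mx2_det => -[ht hd].
have hbc : vge 2 (q 0 1 * q 1 0) := vgeM i2 i3.
have had : vge 1 (q 0 0 * q 1 1).
  rewrite -[_ * _](subrK (q 0 1 * q 1 0)); apply: vgeD; last exact: vgeW hbc.
  by rewrite (vge_fin _ hd).
have [a1 d1] : vge 1 (q 0 0) /\ vge 1 (q 1 1).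
  have [h|h] := vge1M h1 h4 had; split=> //.
    by rewrite -(subKr (q 0 0) (q 1 1)); apply: vgeB.
  by rewrite -(subrK (q 1 1) (q 0 0)); apply: vgeD.
have : vge 2 (q 0 0 * q 1 1 - q 0 1 * q 1 0) by apply: vgeB => //; exact: (vgeM a1 d1).
by rewrite (vge_fin _ hd).
Qed.

Lemma split_conj g q : g \in unitmx -> split_elt q -> split_elt (invmx g *m q *m g).
Proof. by move=> ug; rewrite /split_elt tr_conj ?det_conj. Qed.

Lemma ramified_conj g q : g \in unitmx -> ramified_elt q -> ramified_elt (invmx g *m q *m g).
Proof. by move=> ug; rewrite /ramified_elt tr_conj ?det_conj. Qed.

Lemma apt0_std g q : g \in unitmx -> apt g 0 q -> std (invmx g *m q *m g).
Proof. by move=> ug; rewrite apt0 conj_setE. Qed.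

Lemma long_split q I : reduced_elt q I ->
  (exists D D', [/\ branch nu q D, branch nu q D' & (1 < dist D D')%N]) -> split_elt q.
Proof.
move=> hq [D [D' [h1 h2 h3]]].
have [[EI _]|[n [n1 _ _ /(_ _ _ h1 h2)]]] := reduced_length hq; last by move: h3 n1; lia.
case: hq => [[//]|[_ EI']|[_ EI']].
- have : segment 1 (-1) by rewrite -EI' EI.
  by rewrite /segment /=; lia.
- have : segment 0 (-1) by rewrite -EI' EI.
  by rewrite /segment /=; lia.
Qed.

Lemma not_inert q I : reduced_elt q I ->
  (exists D D', [/\ branch nu q D, branch nu q D' & (0 < dist D D')%N]) ->
  split_elt q \/ ramified_elt q.
Proof.
case=> [[h _] _|[h _] _|[h _] [D [D' [h1 h2 h3]]]]; [by left|by right|].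
have [g ug E] := branch_inert h.
move: h1 h2 h3; rewrite E => -[t ht <-] [t' ht' <-]; rewrite dist_apt //.
by move: ht ht'; rewrite /segment /=; lia.
Qed.

(** An apartment is chosen along the branch of [A], so that only the branch of [A]
    contains [apt h 1]; a common eigenline modulo [pi] would give a common
    neighbor on the other side. *)
Lemma common_point A B I J g : reduced_elt A I -> reduced_elt B J -> g \in unitmx ->
  branch nu A (apt g 0) -> branch nu B (apt g 0) ->
  (exists D D', [/\ branch nu A D, branch nu A D' & (0 < dist D D')%N]) ->
  (forall D D', branch nu A D -> branch nu B D -> branch nu A D' -> branch nu B D' ->
     (dist D D' <= 0)%N) ->
  ~ vge 1 (\det (comm2 A B)).
Proof.
move=> hA hB ug0 A0 B0 longA Hmax.
have typeA := not_inert hA longA; case: longA => D [D' [AD AD' dDD]].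
have v0 : vertex (apt g 0) by exact: vertex_apt.
have [X AX neX] : exists2 X, branch nu A X & apt g 0 <> X.
  case: (pselect (apt g 0 = D)) => [E|nE]; last by exists D.
  exists D' => // E'; move: dDD; rewrite -E -E'.
  by have -> : dist (apt g 0) (apt g 0) = 0%N by apply/dist0.
have [vX _] := (branchE _ _).1 AX.
have [h [uh E1 E2]] := common_apartment v0 vX.
have dX : dist (apt g 0) X <> 0%N by move/(dist0 v0 vX).
rewrite E1 in A0 B0; rewrite E2 in AX.
have A1 : branch nu A (apt h 1) by apply: (branch_convex uh A0 AX); lia.
have [_ mA0] := (branchE _ _).1 A0; have [_ mB0] := (branchE _ _).1 B0.
have [_ mA1] := (branchE _ _).1 A1.
have nB : ~ apt h 1 B.
  move=> B1; have : (dist (apt h 0) (apt h 1) <= 0)%N; last by rewrite dist_apt.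
  by apply: Hmax => //; apply/branchE; split=> //; exact: vertex_apt.
rewrite (det_comm2_conj A B uh).
have sA := apt0_std uh mA0; have sB := apt0_std uh mB0.
have nsA : ~ [/\ vge 1 ((invmx h *m A *m h) 0 0 - (invmx h *m A *m h) 1 1),
     vge 1 ((invmx h *m A *m h) 0 1) & vge 1 ((invmx h *m A *m h) 1 0)].
  apply: reduced_not_scalar => //.
  by case: typeA => hT; [left; exact: split_conj | right; exact: ramified_conj].
have lowA y := @extend_low A h y uh mA0; have lowB y := @extend_low B h y uh mB0.
have nlow y : vge 0 y -> apt (h *m low2 y) (- 1) A -> apt (h *m low2 y) (- 1) B -> False.
  move=> hy mA mB.
  have ul : h *m low2 y \in unitmx by rewrite unitmx_mul uh low2_unit.
  have vl : vertex (apt (h *m low2 y) (- 1)) by exact: vertex_apt.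
  have := Hmax (apt h 0) (apt (h *m low2 y) (- 1)) A0 B0.
  rewrite !branchE => /(_ (conj vl mA) (conj vl mB)).
  by rewrite -(apt_low uh hy (lexx 0)) dist_apt.
move: mA1 nB; rewrite !mem_apt //.
move: (invmx h *m A *m h) (invmx h *m B *m h) sA sB nsA lowA lowB => A' B' sA sB nsA lowA lowB.
move: sA sB => /stdE [i1 i2 i3 i4] /stdE [j1 j2 j3 j4] [_ k2 _ _] nB.
have ub : nu (B' 0 1) = 0%E.
  by apply: int_unit => //; apply/negP => hb; apply: nB; split=> //; apply: vgeW j3.
rewrite (mx2_eta A') (mx2_eta B'); apply: no_common_eigenline => // y hy hyA hyB.
by apply: (nlow y) => //; [apply: lowA | apply: lowB].
Qed.

(** The determinant is, up to higher order, [pi ^ L] times the product of two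
    factors that measure whether the second eigenlines at the two ends of the
    segment differ.  If one of them vanishes modulo [pi], the segment of common
    vertices continues beyond that end. *)
Lemma common_segment A B g L : split_elt A -> split_elt B -> g \in unitmx -> (0 < L)%N ->
  branch nu A (apt g 0) -> branch nu B (apt g 0) ->
  branch nu A (apt g L%:Z) -> branch nu B (apt g L%:Z) ->
  (forall D D', branch nu A D -> branch nu B D -> branch nu A D' -> branch nu B D' ->
     (dist D D' <= L)%N) ->
  ~ vge (L%:Z + 1) (\det (comm2 A B)).
Proof.
move=> hA hB ug L0 A0 B0 AL BL Hmax.
have L1 : 1 <= L%:Z by clear -L0; lia.
have L2 : L%:Z + 1 <= L%:Z + L%:Z by rewrite lerD2l.
have [_ mA0] := (branchE _ _).1 A0; have [_ mB0] := (branchE _ _).1 B0.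
have [_ mAL] := (branchE _ _).1 AL; have [_ mBL] := (branchE _ _).1 BL.
have nlow y : vge 0 y -> apt (g *m low2 y) (- 1) A -> apt (g *m low2 y) (- 1) B -> False.
  move=> hy mA mB.
  have ul : g *m low2 y \in unitmx by rewrite unitmx_mul ug low2_unit.
  have vl : vertex (apt (g *m low2 y) (- 1)) by exact: vertex_apt.
  have := Hmax (apt g L%:Z) (apt (g *m low2 y) (- 1)) AL BL.
  rewrite !branchE => /(_ (conj vl mA) (conj vl mB)).
  rewrite -(@apt_low g y L%:Z) // dist_apt //; clear; lia.
have nupp x : vge L%:Z x -> apt (g *m upp2 x) (L%:Z + 1) A ->
    apt (g *m upp2 x) (L%:Z + 1) B -> False.
  move=> hx mA mB; have hx0 : vge 0 x by apply: vgeW hx.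
  have ul : g *m upp2 x \in unitmx by rewrite unitmx_mul ug upp2_unit.
  have vl : vertex (apt (g *m upp2 x) (L%:Z + 1)) by exact: vertex_apt.
  have := Hmax (apt g 0) (apt (g *m upp2 x) (L%:Z + 1)) A0 B0.
  rewrite !branchE => /(_ (conj vl mA) (conj vl mB)).
  rewrite -(@apt_upp g x L%:Z 0) // dist_apt //; clear; lia.
have lowA y := @extend_low A g y ug mA0; have lowB y := @extend_low B g y ug mB0.
have L0' : 0 <= L%:Z by [].
have uppA x := @extend_upp A g x L%:Z ug L0' mA0.
have uppB x := @extend_upp B g x L%:Z ug L0' mB0.
rewrite (det_comm2_conj A B ug).
have sA := apt0_std ug mA0; have sB := apt0_std ug mB0.
have := split_disc_unit (split_conj ug hA); have := split_disc_unit (split_conj ug hB).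
move: mAL mBL; rewrite !mem_apt //.
move: (invmx g *m A *m g) (invmx g *m B *m g) sA sB lowA lowB uppA uppB =>
  A' B' sA sB lowA lowB uppA uppB.
move: sA sB => /stdE [i1 i2 i3 i4] /stdE [j1 j2 j3 j4] [_ iL _ _] [_ jL _ _] dB dA.
have i2' : vge 1 (A' 0 1) := vgeW L1 iL.
have j2' : vge 1 (B' 0 1) by exact: vgeW L1 jL.
have ue := dA i1 i4 (vgeMr i2' i3).
move=> {dA dB}; rewrite {1}(mx2_eta A') {1}(mx2_eta B') det_comm2.
move: (A' 0 0) (A' 0 1) (A' 1 0) (A' 1 1) (B' 0 0) (B' 0 1) (B' 1 0) (B' 1 1)
  i1 i2 i3 i4 j1 j2 j3 j4 iL jL i2' j2' ue lowA lowB uppA uppB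
  => a b c d a' b' c' d' i1 i2 i3 i4 j1 j2 j3 j4 iL jL i2' j2' ue lowA lowB uppA uppB h.
have ie := vgeB i1 i4; have ie' := vgeB j1 j4.
move: (a - d) (a' - d') ie ie' ue lowA lowB uppA uppB h => e e' ie ie' ue lowA lowB uppA uppB h.
have e0 := nu_neq0 ue.
have hyz : vge (L%:Z + 1) ((e * b' - b * e') * (c * e' - c' * e)).
  rewrite -(subKr (- (b * c' - b' * c) ^+ 2) (_ * _)); apply: vgeB => //.
  rewrite vgeN expr2; have hx : vge L%:Z (b * c' - b' * c) by apply: vgeB; apply: vgeMr.
  exact: vgeW L2 (vgeM hx hx).
have hy : vge L%:Z (e * b' - b * e') by apply: vgeB; [exact: vgeMl | exact: vgeMr].
have hz : vge 0 (c * e' - c' * e) by apply: vgeB; exact: vgeMl.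
have [h1|h1] : vge (L%:Z + 1) (e * b' - b * e') \/ vge 1 (c * e' - c' * e).
- have pL := nu_piz L%:Z.
  have y0 : vge 0 ((e * b' - b * e') / pi ^ L%:Z) by apply: (vge_div pL); rewrite add0r.
  have : vge 1 ((e * b' - b * e') / pi ^ L%:Z * (c * e' - c' * e)).
    by rewrite mulrAC; apply: (vge_div pL); rewrite addrC.
  case/(vge1M y0 hz) => h1; [left|by right].
  rewrite -(divfK (piz_neq0 L%:Z) (e * b' - b * e')) mulrC vge_pi.
  by rewrite addrAC subrr add0r.
(* at the far end, (- b / e, 1) spans the second eigenline of A, also that of B *)
- have xL : vge L%:Z (- b / e) by apply: (vge_div ue); rewrite addr0 vgeN.
  have x2 : vge (L%:Z + 1) ((- b / e) ^+ 2).
    by rewrite expr2; exact: vgeW L2 (vgeM xL xL).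
  apply: (nupp _ xL); [apply: uppA => // | apply: uppB => //].
    rewrite (_ : _ - _ = - ((- b / e) ^+ 2 * c)); last by field.
    by rewrite vgeN; exact: vgeMr.
  rewrite (_ : _ - _ = (e * b' - b * e') / e - (- b / e) ^+ 2 * c'); last by field.
  by apply: vgeB; [apply: (vge_div ue); rewrite addr0 | exact: vgeMr].
(* at the near end, (1, c / e) does *)
have y0 : vge 0 (c / e) by apply: (vge_div ue); rewrite addr0.
have y2 : vge 0 ((c / e) ^+ 2) by exact: vgeX.
apply: (nlow _ y0); [apply: lowA => // | apply: lowB => //].
  rewrite (_ : _ - _ = - ((c / e) ^+ 2 * b)); last by field.
  by rewrite vgeN; exact: vgeMl.
rewrite (_ : _ - _ = - (c * e' - c' * e) / e - (c / e) ^+ 2 * b'); last by field.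
apply: vgeB; last exact: vgeMl.
by apply: (vge_div ue); rewrite addr0 vgeN.
Qed.

(** * Stems of pure quaternions *)

Lemma nuQ_fin x (n : int) : nu x = n%:E -> nuQ nu x = (n%:~R)%:E.
Proof. by move=> h; rewrite /nuQ h. Qed.

Lemma nuQ0 : nuQ nu 0 = +oo%E.
Proof. by rewrite /nuQ nu0. Qed.

Lemma half_pinfty : ((1 / 2)%:E * +oo = +oo :> \bar rat)%E.
Proof. by rewrite gt0_muley. Qed.

Lemma df_double (x : \bar rat) : (- (2%:E * - ((1 / 2)%:E * x)) = x)%E.
Proof.
rewrite muleN oppeK; case: x => [x| |].
- by rewrite -!EFinM mulrA (_ : 2 * (1 / 2) = 1) ?mul1r.
- by rewrite half_pinfty gt0_muley.
- by rewrite gt0_muleNy // gt0_muleNy.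
Qed.

Lemma reduced_has_distance q I (L : nat) : reduced_elt q I -> has_distance (branch nu q) L ->
  (L%:R%:E <= graph_length nu pi (branch nu q))%E /\
  (graph_length nu pi (branch nu q) = L%:R%:E \/
   exists D D', [/\ branch nu q D, branch nu q D' & (L < dist D D')%N]).
Proof.
move=> hq hL; have [[_ [-> hu]]|[n [_ -> [X [X' [hX hX' dX]]] hn]]] := reduced_length hq.
  split; first exact: leey.
  by right; have [D [D' [h1 h2 h3]]] := hu L.+1; exists D, D'; rewrite h3.
have [D [D' [h1 h2 h3]]] := hL; have := hn _ _ h1 h2; rewrite h3 => Ln.
split; first by rewrite lee_fin ler_nat.
move: Ln; rewrite leq_eqVlt => /orP [/eqP ->|lt]; [by left|right].
by exists X, X'; rewrite dX.
Qed.

(** When the intersection is bounded, of length [L], all three terms of the minimum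
    are at least [L], and one of them equals [L] by [common_point] and
    [common_segment]; when it is unbounded, all three are infinite. *)
Lemma reduced_pair A B I J (df : \bar rat) : reduced_elt A I -> reduced_elt B J ->
  df = (- ((1 / 2)%:E * nuQ nu (\det (comm2 A B))))%E ->
  let mi := branch nu A in
  let mj := branch nu B in
  let li := graph_length nu pi mi in
  let lj := graph_length nu pi mj in
  ((0 < df)%E -> exists2 n : nat, df = n%:R%:E & subgraph_dist nu pi mi mj n) /\
  (~ (0 < df)%E -> mi `&` mj !=set0 /\
     graph_length nu pi (mi `&` mj) = Order.min (- (2%:E * df))%E (Order.min li lj)).
Proof.
move=> hA hB Edf mi mj li lj.
have [disj|/set0P ne] := eqVneq (mi `&` mj) set0.
  have [n [n0 hn hd]] := disjoint_branches hA hB disj.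
  have En : df = n%:R%:E.
    rewrite Edf (nuQ_fin hn) -EFinM -EFinN; congr (_%:E).
    by rewrite mulrNz -[(2 * n%:Z)%:~R]mulrzr intrM /=; field.
  split=> [_|h]; first by exists n.
  by case: h; rewrite En lte_fin ltr0n.
have le0 : vge 0 (\det (comm2 A B)).
  have [D [AD BD]] := ne; have [[g ug E] _] := (branchE _ _).1 AD.
  rewrite -apt0 in E; rewrite E in AD BD.
  have [_ mA] := (branchE _ _).1 AD; have [_ mB] := (branchE _ _).1 BD.
  exact: (@common_path A B g 0%N).
split.
  move=> h; exfalso; move: h; rewrite Edf; apply/negP; rewrite -leNgt.
  have [E|dn] := eqVneq (\det (comm2 A B)) 0; first by rewrite E nuQ0 half_pinfty leNye.
  have [n hn] := nu_fin dn; move: le0; rewrite (vge_fin _ hn) => n0.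
  by rewrite (nuQ_fin hn) -EFinM -EFinN lee_fin oppr_le0 mulr_ge0 // ler0z.
move=> _; split=> //; rewrite Edf df_double.
have sub := subtreeI (subtree_branch A) (subtree_branch B); rewrite -/mi -/mj in sub.
have len_le L : has_distance (mi `&` mj) L -> vge L%:Z (\det (comm2 A B)).
  move=> [D [D' [[AD BD] [AD' BD'] dD]]].
  have [vD mA] := (branchE _ _).1 AD; have [_ mB] := (branchE _ _).1 BD.
  have [vD' mA'] := (branchE _ _).1 AD'; have [_ mB'] := (branchE _ _).1 BD'.
  have [g [ug E1 E2]] := common_apartment vD vD'.
  by apply: (@common_path A B g) => //; rewrite -?E1 // -dD -E2.
case: (pselect (exists M : nat, forall L, has_distance (mi `&` mj) L -> (L <= M)%N)) => [[M hM]|unb].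
  pose P n := `[< has_distance (mi `&` mj) n >].
  have exP : exists n, P n.
    have [D D2] := ne; exists (dist D D); apply/asboolP; by exists D, D.
  have bd n : P n -> (n <= M)%N by move/asboolP/hM.
  case: (ex_maxnP exP bd) => L /asboolP hL Lmax.
  have Lmax' D D' : (mi `&` mj) D -> (mi `&` mj) D' -> (dist D D' <= L)%N.
    by move=> h h'; apply: Lmax; apply/asboolP; exists D, D'.
  have [h uh Eh] := branch_reduced hA.
  have [|g [ug Eg [A0 B0] [AL BL]]] := bounded_subtree uh sub _ hL Lmax'.
    by move=> D [mD _]; move: mD; rewrite /mi Eh => -[t _ <-]; exists t.
  rewrite Eg length_segment //.
  have lA : has_distance mi L by have [D [D' [[? _] [? _] ?]]] := hL; exists D, D'.
  have lB : has_distance mj L by have [D [D' [[_ ?] [_ ?] ?]]] := hL; exists D, D'.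
  have [geA cA] := reduced_has_distance hA lA; have [geB cB] := reduced_has_distance hB lB.
  have geC : (L%:R%:E <= nuQ nu (\det (comm2 A B)))%E.
    have [->|dn] := eqVneq (\det (comm2 A B)) 0; first by rewrite nuQ0 leey.
    have [n hn] := nu_fin dn; have := len_le _ hL.
    by rewrite (vge_fin _ hn) (nuQ_fin hn) lee_fin [L%:R]pmulrn ler_int.
  suff : [\/ nuQ nu (\det (comm2 A B)) = L%:R%:E, li = L%:R%:E | lj = L%:R%:E].
    case=> E; apply/eqP; rewrite eq_le !le_min !ge_min geA geB geC E lexx ?orbT //=.
  case: cA => [E|longA]; first by constructor 2.
  case: cB => [E|longB]; first by constructor 3.
  constructor 1; rewrite [L%:R]pmulrn; apply: nuQ_fin.
  apply: vge_eq; first exact: len_le.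
  have Hmax D D' : branch nu A D -> branch nu B D -> branch nu A D' -> branch nu B D' ->
     (dist D D' <= L)%N by move=> *; apply: Lmax'.
  apply/negP; case: (posnP L) => [L0|Lpos].
    by rewrite L0 in Hmax longA *; apply: (common_point hA hB ug A0 B0 longA Hmax).
  have long1 q : (exists D D', [/\ branch nu q D, branch nu q D' & (L < dist D D')%N]) ->
      exists D D', [/\ branch nu q D, branch nu q D' & (1 < dist D D')%N].
    by move=> [D [D' [h1 h2 h3]]]; exists D, D'; split=> //; exact: leq_ltn_trans h3.
  by apply: (common_segment (long_split hA (long1 _ longA)) (long_split hB (long1 _ longB)) ug).
have big n : exists2 m, (n <= m)%N & has_distance (mi `&` mj) m.
  apply: contrapT => nh; apply: unb; exists n => L hL; rewrite leqNgt; apply/negP => lt.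
  by apply: nh; exists L => //; exact: ltnW.
have d0 : \det (comm2 A B) = 0.
  by apply: vge_all0 => n; have [m nm /len_le h] := big n; apply: vgeW h; rewrite lez_nat.
have inf X : subtree X -> mi `&` mj `<=` X -> graph_length nu pi X = +oo%E.
  move=> sX subX; apply: length_unbounded => // n.
  have [m nm [D [D' [h1 h2 h3]]]] := big n.
  by exists D, D'; rewrite h3; split=> //; exact: subX.
have infA : li = +oo%E by apply: inf; [exact: subtree_branch | move=> D []].
have infB : lj = +oo%E by apply: inf; [exact: subtree_branch | move=> D []].
by rewrite d0 nuQ0 infA infB inf // !minxx.
Qed.

Lemma det_pure (q : M2) a : \tr q = 0 -> q *m q = a%:M -> \det q = - a.
Proof.
rewrite (mx2_eta q) mx2_tr mx2_det mx2M mx2_scalar => ht.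
have -> : q 1 1 = - q 0 0 by apply/eqP; rewrite -addr_eq0 addrC ht.
by move/matrixP/(_ 0 0); rewrite !mx2E => <-; ring.
Qed.

Lemma pure_shift (q : M2) a b rho (q' := rho^-1 *: (q - b%:M)) : rho != 0 ->
  \tr q = 0 -> q *m q = a%:M ->
  [/\ q = b%:M + rho *: q', \tr q' = - (2 * b) / rho & \det q' = (b ^+ 2 - a) / rho ^+ 2].
Proof.
move=> r0 ht hq; have hd := det_pure ht hq; split.
- by rewrite scalerA divff // scale1r addrC subrK.
- move: ht; rewrite /q' (mx2_eta q) mx2_scalar mx2N mx2D mx2Z !mx2_tr => ht.
  by rewrite (_ : _ + _ = rho^-1 * (q 0 0 + q 1 1 - 2 * b)); [rewrite ht; ring | ring].
- move: ht hd; rewrite /q' (mx2_eta q) mx2_scalar mx2N mx2D mx2Z mx2_tr !mx2_det => ht hd.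
  rewrite (_ : a = - (q 0 0 * q 1 1 - q 0 1 * q 1 0)); last by rewrite hd opprK.
  have -> : q 1 1 = - q 0 0 by apply/eqP; rewrite -addr_eq0 addrC ht.
  by field.
Qed.

Lemma comm2_shift b rho A b' rho' B :
  comm2 (b%:M + rho *: A) (b'%:M + rho' *: B) = (rho * rho') *: comm2 A B.
Proof.
rewrite /comm2 (mx2_eta A) (mx2_eta B) !mx2_scalar !mx2Z !mx2D !mx2M !mx2N !mx2D mx2Z.
by congr mx2; ring.
Qed.

Lemma det_comm2_pure (A B : M2) a b l : \tr A = 0 -> \tr B = 0 ->
  A *m A = a%:M -> B *m B = b%:M -> A *m B + B *m A = (2 * l)%:M ->
  \det (comm2 A B) = - (4 * (l ^+ 2 - a * b)).
Proof.
move=> tA tB hA hB hAB; have dA := det_pure tA hA; have dB := det_pure tB hB.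
have -> : 4 * (l ^+ 2 - a * b) = (2 * l) ^+ 2 - 4 * (- \det A * - \det B).
  by rewrite dA dB; ring.
move: tA tB hAB; rewrite (mx2_eta A) (mx2_eta B) !mx2M mx2D mx2_scalar !mx2_tr det_comm2 !mx2_det.
have e11 (X : M2) : X 0 0 + X 1 1 = 0 -> X 1 1 = - X 0 0.
  by move=> h; apply/eqP; rewrite -addr_eq0 addrC h.
move=> /e11 -> /e11 -> /matrixP/(_ 0 0); rewrite !mx2E => <-; ring.
Qed.

Lemma det_scale2 e (A : M2) : \det (e *: A) = e ^+ 2 * \det A.
Proof. by rewrite (mx2_eta A) mx2Z !mx2_det; ring. Qed.

Section Classes.
Hypothesis hc : complete_valuation nu.
Hypothesis hres : finite_residue_field nu.
Hypothesis h2 : 2%:R != 0 :> k.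

(** By [stem_reduced], the stem of [q] is then the branch of [q']; the scalar [b]
    is hidden because commutators do not see it. *)
Definition reduction (q : M2) (rho : k) (q' : M2) (I : set int) : Prop :=
  reduced_elt q' I /\ exists b, [/\ vge 0 b, exists r : nat, nu rho = r%:Z%:E &
    q = b%:M + rho *: q'].

Lemma reduction_unramified Delta q a : is_min_defect_unit nu Delta ->
  [set 1; Delta] a -> \tr q = 0 -> q *m q = a%:M ->
  exists q' I, reduction q 2 q' I.
Proof.
move=> hD ha ht hq; have [e he] := nu2_fin h2.
case: ha => /= Ea; rewrite {}Ea in hq.
  have [E tq dq] := pure_shift (- 1) h2 ht hq.
  exists (2^-1 *: (q - (- 1)%:M)), setT; split.
    constructor 1; split=> //; split; first by rewrite tq; field.
    by rewrite dq sqrrN expr1n subrr mul0r.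
  by exists (- 1); split=> //; [rewrite vgeN vge1 | exists e].
have [b [c [hb hc' ED irr]]] := unramified_generator hc hres h2 hD.
have [E tq dq] := pure_shift b h2 ht hq.
have {}tq : \tr (2^-1 *: (q - b%:M)) = - b by rewrite tq; field.
have {}dq : \det (2^-1 *: (q - b%:M)) = - c by rewrite dq ED; field; exact: (two_sqr_neq0 h2).
exists (2^-1 *: (q - b%:M)), (segment 0); split; last by exists b; split=> //; exists e.
constructor 3; split=> //; split; rewrite ?tq ?dq ?vgeN // => r hr.
by rewrite mulNr opprK; exact: irr.
Qed.

Lemma reduction_ramified q a (s : nat) : nu a = 0%E \/ nu a = 1%:E ->
  is_quadratic_defect nu a (frac_ideal nu (pi ^+ (2 * s + 1))) ->
  \tr q = 0 -> q *m q = a%:M -> exists q' I, reduction q (pi ^+ s) q' I.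
Proof.
move=> ha hdef ht hq.
have [b [c [hb hc' Ea h2b]]] := ramified_generator hc h2 ha hdef.
have ps0 : pi ^+ s != 0 by rewrite expf_neq0 // pi0.
have hps : nu (pi ^+ s) = s%:Z%:E by rewrite exprnP nu_piz.
have [E tq dq] := pure_shift b ps0 ht hq.
exists ((pi ^+ s)^-1 *: (q - b%:M)), (segment 1); split; last by exists b; split=> //; exists s.
constructor 2; split=> //; split; rewrite ?tq ?dq.
  by apply: (vge_div hps); rewrite vgeN addrC.
rewrite (_ : _ / _ = - (pi * c)); first by rewrite nuN (nuM hpi hc') addr0.
rewrite Ea mul2n -addnn !exprD expr1; field; exact: ps0.
Qed.

(** This absorbs the factors [rho] into [df]. *)
Lemma df_shift c x (m : nat) : nu c = (2 * m%:Z)%:E ->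
  (m%:R%:E - (1 / 2)%:E * nuQ nu (c * x) = - ((1 / 2)%:E * nuQ nu x))%E.
Proof.
move=> hcm; have [->|x0] := eqVneq x 0; first by rewrite mulr0 nuQ0 half_pinfty.
have [n hn] := nu_fin x0; rewrite (nuQ_fin hn) (nuQ_fin (nuM hcm hn)).
rewrite -!EFinM -!EFinN -EFinD; congr (_%:E).
by rewrite intrD intrM -[m%:~R]/(m%:R) /=; field.
Qed.

Lemma stems_of_reductions i j rho rho' i' j' I J (df : \bar rat) :
  reduction i rho i' I -> reduction j rho' j' J ->
  df = (- ((1 / 2)%:E * nuQ nu (\det (comm2 i' j'))))%E ->
  let mi := stem nu pi i in
  let mj := stem nu pi j in
  let li := graph_length nu pi mi in
  let lj := graph_length nu pi mj in
  [/\ [set 0%E; 1%:E; +oo%E] li, [set 0%E; 1%:E; +oo%E] lj,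
      (0 < df)%E ->
        exists2 n : nat, df = n%:R%:E & subgraph_dist nu pi mi mj n &
      ~ (0 < df)%E ->
        mi `&` mj !=set0 /\
        graph_length nu pi (mi `&` mj) =
          Order.min (- (2%:E * df))%E (Order.min li lj)].
Proof.
move=> [hi [b [hb [r hr] ->]]] [hj [b' [hb' [r' hr'] ->]]] Edf.
rewrite /= (stem_reduced hi hb hr) (stem_reduced hj hb' hr').
have [H1 H2] := reduced_pair hi hj Edf.
by split=> //; [exact: reduced_length_set hi | exact: reduced_length_set hj].
Qed.

End Classes.
End Valuation.

Theorem theorem2p1 (k : fieldType) (nu : k -> \bar int) (pi : k)
    (N : nat) (Delta : k) (u : 'I_N -> k) (p : 'I_(N + 2) -> k)
    (i j : 'M[k]_2) (alpha beta lambda : k) (df : \bar rat) :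
  nonarch_local_field nu ->
  2%N \notin [pchar k] ->
  is_uniformizer nu pi ->
  square_class_system nu Delta u p ->
  \tr i = 0 -> \tr j = 0 ->
  i *m i = alpha%:M -> j *m j = beta%:M ->
  i *m j + j *m i = (2 * lambda)%:M ->
  repQ Delta u p alpha -> repQ Delta u p beta ->
  df_spec nu pi Delta alpha beta lambda df ->
  let mi := stem nu pi i in
  let mj := stem nu pi j in
  let li := graph_length nu pi mi in
  let lj := graph_length nu pi mj in
  [/\ [set 0%E; 1%:E; +oo%E] li, [set 0%E; 1%:E; +oo%E] lj,
      (0 < df)%E ->
        exists2 n : nat, df = n%:R%:E & subgraph_dist nu pi mi mj n &
      ~ (0 < df)%E ->
        mi `&` mj !=set0 /\
        graph_length nu pi (mi `&` mj) =
          Order.min (- (2%:E * df))%E (Order.min li lj)].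
Proof.
move=> [hv hc hres] char2 hpi hsys ti tj hi hj hij Qa Qb hdf.
have h2 : 2%:R != 0 :> k by move: char2; rewrite inE.
have hD := scs_Delta hsys.
have ram a : repQ Delta u p a -> ~ [set 1; Delta] a -> nu a = 0%E \/ nu a = 1%:E.
  move=> [[//|ua] _|pa _]; first by left; have [] := (scs_u hsys).1 _ ua.
  by right; have := (scs_p hsys).1 _ pa.
have unr q a := @reduction_unramified k nu hv hc hres h2 Delta q a hD.
have rmf q a s na := @reduction_ramified k nu pi hv hpi hc h2 q a s na.
have det_eq rho rho' i' j' I J : reduction nu i rho i' I -> reduction nu j rho' j' J ->
    4 * (lambda ^+ 2 - alpha * beta) = - ((rho * rho') ^+ 2 * \det (comm2 i' j')).
  move=> [_ [b [_ _ Ei]]] [_ [b' [_ _ Ej]]].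
  rewrite -[LHS]opprK -(det_comm2_pure ti tj hi hj hij) {1}Ei {1}Ej.
  by rewrite comm2_shift det_scale2.
have four : 4 = 2 ^+ 2 :> k by ring.
have n4 : 4 != 0 :> k by rewrite four expf_neq0.
have pt2 (t : nat) : nu (- (pi ^+ t) ^+ 2) = (2 * t%:Z)%:E.
  by rewrite (nuN hv) -exprM exprnP (nu_piz hv hpi); congr (_%:E); lia.
case: hdf => [ha hb|t ha nb db|s na da hb|s t na nb da db].
- have [i' [I ri]] := unr _ _ ha ti hi; have [j' [J rj]] := unr _ _ hb tj hj.
  apply: (stems_of_reductions hv hpi ri rj); have E := det_eq _ _ _ _ _ _ ri rj.
  rewrite -[nuQ nu (\det _)](_ : nuQ nu (- \det (comm2 i' j')) = _); last by rewrite /nuQ (nuN hv).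
  congr (- (_ * nuQ nu _))%E; apply: (mulfI n4); rewrite mulrCA divff // mulr1.
  by apply: (mulfI n4); rewrite E; ring.
- have [i' [I ri]] := unr _ _ ha ti hi; have [j' [J rj]] := rmf _ _ _ (ram _ Qb nb) db tj hj.
  apply: (stems_of_reductions hv hpi ri rj); have E := det_eq _ _ _ _ _ _ ri rj.
  rewrite -[RHS](df_shift hv _ (pt2 t)); congr (_ - _ * nuQ nu _)%E.
  by apply: (mulfI n4); rewrite E; ring.
- have [i' [I ri]] := rmf _ _ _ (ram _ Qa na) da ti hi; have [j' [J rj]] := unr _ _ hb tj hj.
  apply: (stems_of_reductions hv hpi ri rj); have E := det_eq _ _ _ _ _ _ ri rj.
  rewrite -[RHS](df_shift hv _ (pt2 s)); congr (_ - _ * nuQ nu _)%E.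
  by apply: (mulfI n4); rewrite E; ring.
have [i' [I ri]] := rmf _ _ _ (ram _ Qa na) da ti hi.
have [j' [J rj]] := rmf _ _ _ (ram _ Qb nb) db tj hj.
apply: (stems_of_reductions hv hpi ri rj); have E := det_eq _ _ _ _ _ _ ri rj.
rewrite -[RHS](df_shift hv _ (pt2 (s + t)%N)) natrD EFinD E; congr (_ - _ * nuQ nu _)%E.
by rewrite exprD; ring.
Qed.
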